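(* Let $K$ be a number field, $\Sigma$ a finite set of nonzero prime ideals of $\mathcal O_K$, and $f$ an admissible function from the set of nonzero prime ideals of $\mathcal O_K$ outside $\Sigma$ to the positive integers. For $\operatorname{Re}(s)>1$, $$H_{K,f,\Sigma}(s):=\sum_{m\ge1}\frac{h_{K,f,\Sigma}(m)}{m^s}=\sum_{\mathfrak p\notin\Sigma}\frac{\log\mathrm N\mathfrak p}{f(\mathfrak p)^s(1-(\mathrm N\mathfrak p)^{-s})},$$ and $$D_{K,f,\Sigma}(s):=\sum_{n\ge1}\frac{B_{K,f,\Sigma}(n)}{n^s}=\zeta(s)H_{K,f,\Sigma}(s),$$ where $\zeta$ is the Riemann zeta function. All series converge absolutely in this half-plane.
   Context: Notation: $\mathfrak p$ runs over nonzero prime ideals of $\mathcal O_K$, $\mathrm N\mathfrak p=|\mathcal O_K/\mathfrak p|$, and $\mathcal O_{K,\Sigma}=\{x\in K: v_{\mathfrak p}(x)\ge 0\text{ for every }\mathfrak p\notin\Sigma\}$. The function $f$ is admissible if there exist constants $c>0$ and $\delta>0$ with $f(\mathfrak p)=c\,\mathrm N\mathfrak p+O((\mathrm N\mathfrak p)^{1-\delta})$, uniformly over $\mathfrak p\notin\Sigma$. For a nonzero integral ideal $\mathfrak a$ of $\mathcal O_{K,\Sigma}$, $\mathrm N_\Sigma(\mathfrak a)=\prod_{\mathfrak p\notin\Sigma}(\mathrm N\mathfrak p)^{v_{\mathfrak p}(\mathfrak a)}$. The factorial ideals are $0!_{K,f,\Sigma}=\mathcal O_{K,\Sigma}$ and,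 for $n\ge1$, the integral ideal $n!_{K,f,\Sigma}$ of $\mathcal O_{K,\Sigma}$ with $v_{\mathfrak p}(n!_{K,f,\Sigma})=\sum_{k\ge0}\lfloor n/(f(\mathfrak p)(\mathrm N\mathfrak p)^k)\rfloor$ for $\mathfrak p\notin\Sigma$. The increments are $$B_{K,f,\Sigma}(n)=\log\mathrm N_\Sigma(n!_{K,f,\Sigma})-\log\mathrm N_\Sigma((n-1)!_{K,f,\Sigma})\qquad(n\ge1),$$ and $$h_{K,f,\Sigma}(m)=\sum_{\substack{\mathfrak p\notin\Sigma,\ k\ge0\\ f(\mathfrak p)(\mathrm N\mathfrak p)^k=m}}\log\mathrm N\mathfrak p\qquad(m\ge1).$$ *)

(* Defs.v *)
From HB Require Import structures.
From mathcomp Require Import all_boot all_order all_algebra all_field.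
From mathcomp Require Import finmap complex.
From mathcomp Require Import all_classical all_reals all_analysis.
From mathcomp.analysis.showcase Require summability.

Set Implicit Arguments.
Unset Strict Implicit.
Unset Printing Implicit Defensive.

Import Order.TTheory GRing.Theory Num.Theory.
Import numFieldNormedType.Exports.

Local Open Scope classical_set_scope.
Local Open Scope ring_scope.

Section Arithmetic.
Variable K : fieldExtType rat.

Definition OK : set K := [set x | integralOver (intr : int -> K) x].

(* Rings and ideals are subsets of K; A is meant to be a subring. *)
Definition is_ideal (A I : set K) :=
  [/\ I `<=` A, I 0, forall x y, I x -> I y -> I (x + y)
    & forall a x, A a -> I x -> I (a * x)].

Definition nonzero_ideal (A I : set K) :=
  is_ideal A I /\ exists2 x, I x & x != 0.

Definition nzprime : set (set K) := [set P |
  [/\ nonzero_ideal OK P, ~ P 1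
    & forall x y, OK x -> OK y -> P (x * y) -> P x \/ P y]].

Definition cosets (P : set K) : set (set K) :=
  [set [set x + y | y in P] | x in OK].

Definition idnorm (P : set K) : nat := #|` fset_set (cosets P)|%fset.

Definition ideal_mul (I J : set K) : set K := [set x |
  exists2 s : seq (K * K), (forall u, u \in s -> I u.1 /\ J u.2)
    & x = \sum_(u <- s) u.1 * u.2].

Definition ideal_exp (I : set K) (n : nat) : set K :=
  iter n (ideal_mul I) OK.

(* Exponent of the prime P in the factorization of the ideal a OK,
   for nonzero a in OK: the largest n such that a lies in P ^ n. *)
Definition ord_prime (P : set K) (a : K) : nat :=
  xget 0%N [set n | ideal_exp P n a /\ ~ ideal_exp P n.+1 a].

Definition val_prime (P : set K) (x : K) : \bar int :=
  if x == 0 then +oo%E else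
  (xget 0 [set z : int | exists a b : K,
     [/\ OK a /\ OK b, a != 0 /\ b != 0, x = a / b
       & z = (ord_prime P a)%:Z - (ord_prime P b)%:Z]])%:E.

(* The valuation of an ideal is the least valuation of its elements. *)
Definition val_ideal (P : set K) (I : set K) : int :=
  xget 0 [set z : int | (exists2 x, I x & val_prime P x = z%:E) /\
                        (forall x, I x -> (z%:E <= val_prime P x)%E)].

Variable Sigma : set (set K).

Definition primes_outside : set (set K) := nzprime `\` Sigma.

Definition OKS : set K :=
  [set x | forall P, primes_outside P -> (0 <= val_prime P x)%E].

(* In what follows f is total, but only its values on the primes outside
   Sigma are used.  The sums and products over \in are those of fsbigop:
   they range over the indices whose term is not neutral, which form a
   finite set in all the cases below. *)
Variable f : set K -> nat.

Definition fact_val (n : nat) (P : set K) : nat :=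
  (\big[addn/0]_(k \in [set: nat]) (n %/ (f P * idnorm P ^ k)))%N.

Definition factorial_ideal (n : nat) : set K :=
  if n is 0%N then OKS else
  get [set I : set K | nonzero_ideal OKS I /\
        forall P, primes_outside P -> val_ideal P I = (fact_val n P)%:Z].

Variable R : realType.

Definition normS (I : set K) : R :=
  \big[*%R/1]_(P \in primes_outside) ((idnorm P)%:R : R) ^ val_ideal P I.

Definition admissible :=
  (forall P, primes_outside P -> (0 < f P)%N) /\
  exists c delta M : R, [/\ 0 < c, 0 < delta
    & forall P, primes_outside P ->
        `|(f P)%:R - c * (idnorm P)%:R| <= M * (idnorm P)%:R `^ (1 - delta)].

Definition Bincr (n : nat) : R :=
  ln (normS (factorial_ideal n)) - ln (normS (factorial_ideal n.-1)).

Definition hcoef (m : nat) : R :=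
  \sum_(u \in [set u : set K * nat |
                 primes_outside u.1 /\ (f u.1 * idnorm u.1 ^ u.2)%N = m])
    ln ((idnorm u.1)%:R : R).

End Arithmetic.

Section Series.
Variable R : realType.
Local Open Scope complex_scope.

Definition cexp (z : R[i]) : R[i] :=
  (expR (complex.Re z))%:C * (cos (complex.Im z) +i* sin (complex.Im z)).

Definition natpow (n : nat) (s : R[i]) : R[i] := cexp (s * (ln (n%:R : R))%:C).

(* The Dirichlet series of a; the index is shifted as series starts at 0. *)
Definition dirichlet_term (a : nat -> R[i]) (s : R[i]) : nat -> R[i]^o :=
  fun n => a n.+1 / natpow n.+1 s.

Definition dirichlet (a : nat -> R[i]) (s : R[i]) : R[i] :=
  limn (series (dirichlet_term a s)).

Definition dirichlet_abs_cvg (a : nat -> R[i]) (s : R[i]) :=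
  cvgn (series (fun n => Normc.normc (dirichlet_term a s n))).

(* The Riemann zeta function on the half-plane 1 < Re s. *)
Definition zeta (s : R[i]) : R[i] := dirichlet (fun=> 1) s.

(* Unordered sum over D: the limit of the finite partial sums. *)
Definition sum_over (T : choiceType) (D : set T) (F : T -> R[i]) : R[i] :=
  summability.sum (fun x => (if x \in D then F x else 0) : R[i]^o).

Definition abs_summable (T : choiceType) (D : set T) (F : T -> R[i]) :=
  summable D (fun x => (Normc.normc (F x))%:E).

Variables (K : fieldExtType rat) (Sigma : set (set K)) (f : set K -> nat).

Definition Hseries (s : R[i]) : R[i] :=
  dirichlet (fun m => (hcoef Sigma f R m)%:C) s.

Definition Dseries (s : R[i]) : R[i] :=
  dirichlet (fun n => (Bincr Sigma f R n)%:C) s.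

Definition prime_term (s : R[i]) (P : set K) : R[i] :=
  (ln ((idnorm P)%:R : R))%:C /
    (natpow (f P) s * (1 - natpow (idnorm P) (- s))).

End Series.

(* Main.v *)
Require Import Defs.
From mathcomp Require Import all_boot all_order all_algebra all_field.
From mathcomp Require Import finmap complex.
From mathcomp Require Import all_classical all_reals all_analysis.
From mathcomp Require Import ring lra.

(** The notions of the statement rest on choice: [ord_prime], [val_prime] and [val_ideal] use
    [xget], and [factorial_ideal] uses [get]. Each returns a default value when no candidate exists,
    so nothing can be computed before existence, and uniqueness for [xget], are known; this is why a
    local theory of P precedes the increments. Unique factorization of ideals is not invoked. With t
    a local generator of P and g the multiplier b / p of the overview, membership in t ^ n OK_P is
    expressed by equations w z = t ^ n a with w outside P, and a dependence with a coefficient prime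
    to p does the work of an integral basis.

    On the analytic side the statement mixes limits of partial sums with unordered sums. Both are
    obtained from [has_sum], which depends on no enumeration, so that one lemma on grouping terms
    along a map serves all the identities. *)

(* Each nonzero prime P of the ring of integers contains a rational prime p,
   and a Z-linear dependence among more than [K : Q] elements can be taken with
   a coefficient prime to p.  This bounds the quotient by p, the number of
   primes over p and the exponent of P in p.  Since some b / p outside the ring
   of integers maps P into it, and powers of b / p repeat modulo integers if it
   maps P into P, the prime P is locally principal, whence its valuation is
   additive and the factorial ideals exist.  As
   floor (n / d) - floor ((n - 1) / d) = [d | n], the increment B(n) is the sum
   of log N P over the pairs (P, k) such that f(P) N(P)^k divides n.

   The analytic identities are rearrangements of two absolutely convergent sums:
   log N P / (f(P) N(P)^k)^s over the pairs (P, k), grouped by P or by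
   f(P) N(P)^k, and its product with q^-s over the triples (q, P, k), grouped by
   q or by q f(P) N(P)^k.  Convergence follows from f(P) >= c N(P) and from the
   bound [K : Q] on the number of primes over p. *)

Set Implicit Arguments.
Unset Strict Implicit.
Unset Printing Implicit Defensive.

Import Order.TTheory GRing.Theory Num.Theory.
Import numFieldNormedType.Exports.

Local Open Scope classical_set_scope.
Local Open Scope ring_scope.

(** * Integral elements and integer dependences *)

Section AlgebraicIntegers.
Variable K : fieldExtType rat.
Implicit Types (x y a b : K) (p : nat).

Lemma intrK_eq0 (z : int) : (z%:~R == 0 :> K) = (z == 0).
Proof. by rewrite -(rmorph_int (in_alg K)) fmorph_eq0 intr_eq0. Qed.

Lemma OK_int (z : int) : OK (z%:~R : K).
Proof. exact: (@integral_id _ _ (intr : int -> K)). Qed.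

Lemma OK_nat (n : nat) : OK (n%:R : K).
Proof. exact: integral_nat. Qed.

Lemma OK0 : OK (0 : K). Proof. exact: mxpoly.integral0. Qed.
Lemma OK1 : OK (1 : K). Proof. exact: integral1. Qed.

Lemma OKD x y : OK x -> OK y -> OK (x + y).
Proof. exact: integral_add. Qed.

Lemma OKN x : OK x -> OK (- x).
Proof. exact: integral_opp. Qed.

Lemma OKB x y : OK x -> OK y -> OK (x - y).
Proof. exact: integral_sub. Qed.

Lemma OKM x y : OK x -> OK y -> OK (x * y).
Proof. exact: integral_mul. Qed.

Lemma OKX x n : OK x -> OK (x ^+ n).
Proof. by move=> Ox; elim: n => [|n IH]; [exact: OK1|rewrite exprS; apply: OKM]. Qed.

Lemma OK_sum (I : eqType) (r : seq I) (F : I -> K) :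
  (forall i, i \in r -> OK (F i)) -> OK (\sum_(i <- r) F i).
Proof.
by move=> OF; rewrite big_seq; apply: big_ind => //; [exact: OK0|exact: OKD].
Qed.

Lemma int_dependence m (x : nat -> K) : (\dim {:K} < m)%N ->
  exists2 a : nat -> int, \sum_(i < m) (a i)%:~R * x i = 0 &
    exists2 i, (i < m)%N & a i != 0.
Proof.
move=> dm.
pose X := [tuple x i | i < m].
have nf : ~~ free X.
  apply: contraL dm; rewrite -leqNgt /free => /eqP fX.
  by rewrite -(size_tuple X) -fX; apply/dimvS/subvf.
have [k k0 [i ki]] : exists2 k : 'I_m -> rat,
    \sum_(i < m) k i *: x i = 0 & exists i, k i != 0.
  apply: contrapT => H; case/negP: nf; apply/freeP => k k0 i.
  apply/eqP; apply: contrapT => /negP ki; apply: H; exists k; last by exists i.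
  by rewrite -[RHS]k0; apply: eq_bigr => j _; rewrite -tnth_nth tnth_mktuple.
pose D := \prod_(i < m) denq (k i).
have D0 : D != 0 by apply/prodf_neq0 => j _; apply: denq_neq0.
(* This is [D * k j] written as an integer: the factor of [D] left out is the denominator of
   [k j]. *)
pose e (j : 'I_m) := numq (k j) * \prod_(l < m | l != j) denq (k l).
have eE j : (e j)%:~R = D%:~R * k j.
  by rewrite /D (bigD1 j) //= /e !intrM numqE; ring.
exists (fun n => oapp e 0 (insub n)).
  transitivity (D%:~R *: \sum_(i < m) k i *: x i); last by rewrite k0 scaler0.
  rewrite scaler_sumr; apply: eq_bigr => j _.
  rewrite insubT //= => jm; rewrite (_ : Sub _ _ = j); last exact: val_inj.
  by rewrite mulrzl -scaler_int eE scalerA.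
exists i => //; rewrite insubT //= => im; rewrite -(intr_eq0 rat).
rewrite (_ : Sub _ _ = i); last exact: val_inj.
by rewrite eE mulf_neq0 // intr_eq0.
Qed.

(** Descent on the sum of the absolute values: as long as p divides every coefficient, dividing the
    relation by p gives a smaller one. *)
Lemma primitive_dependence p m (x : nat -> K) : prime p -> (\dim {:K} < m)%N ->
  exists2 a : nat -> int, \sum_(i < m) (a i)%:~R * x i = 0 &
    exists2 i, (i < m)%N & ~~ (p%:Z %| a i)%Z.
Proof.
move=> pp /(int_dependence x)[a a0 ai].
move: {2}(\sum_(i < m) `|a i|%N)%N (leqnn (\sum_(i < m) `|a i|%N)%N) => N.
elim/ltn_ind: N a a0 ai => N IH a a0 [i im ai] leN.
have [dv|] := pselect (forall i, (i < m)%N -> (p%:Z %| a i)%Z); last first.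
  by move=> /existsNP[j /not_implyP[jm /negP nj]]; exists a => //; exists j.
have p0 : p%:Z != 0 by rewrite -[0]/(Posz 0) eqz_nat -lt0n prime_gt0.
pose b j := (a j %/ p%:Z)%Z.
have aE (j : 'I_m) : a j = b j * p%:Z by rewrite divzK ?dv.
have abE (j : 'I_m) : `|a j|%N = (`|b j| * p)%N by rewrite aE abszM.
have bi : b i != 0 by apply: contra_neq ai => bi; rewrite (aE (Ordinal im)) bi mul0r.
apply: (IH (\sum_(i < m) `|b i|%N)%N _ b) => //.
- apply: leq_trans leN.
  rewrite (eq_bigr _ (fun j _ => abE j)) -big_distrl /= ltn_Pmulr ?prime_gt1 //.
  by rewrite (bigD1 (Ordinal im)) //= addn_gt0 absz_gt0 bi.
- have pK : p%:Z%:~R != 0 :> K by rewrite intrK_eq0.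
  apply: (mulIf pK); rewrite mul0r mulr_suml -[RHS]a0; apply: eq_bigr => j _.
  by rewrite aE intrM mulrAC.
- by exists i.
Qed.

(** A nonzero polynomial killing a, stripped of its factors X, reads q X + c with c nonzero, and
    then c = - a q(a). *)
Lemma OK_dvd_int a : OK a -> a != 0 ->
  exists2 z : int, z != 0 & exists2 b, OK b & z%:~R = a * b.
Proof.
move=> Oa a0; have [q /monic_neq0] := Oa.
elim/poly_ind: q => [|q c IH]; first by rewrite eqxx.
rewrite /root rmorphD rmorphM /= map_polyX map_polyC /= !hornerE.
have [-> |c0 _ /eqP h] := eqVneq c 0.
  rewrite addr0 mulf_eq0 polyX_eq0 orbF addr0 mulf_eq0 (negPf a0) orbF.
  exact: IH.
exists c => //; exists (- (map_poly intr q).[a]).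
  apply: OKN; apply: integral_horner => //.
  by apply/integral_poly => i; rewrite coef_map; apply: OK_int.
by rewrite mulrN mulrC; apply/eqP; rewrite -addr_eq0 addrC; apply/eqP.
Qed.

Lemma int_mul_OK x : exists2 z : int, z != 0 & OK (z%:~R * x).
Proof.
have [a a0 [i im ai]] := int_dependence (fun i => x ^+ i) (ltnSn (\dim {:K})).
pose q : {poly int} := \poly_(i < (\dim {:K}).+1) a i.
have q0 : q != 0.
  by apply/eqP => /(congr1 (coefp i)) /eqP; rewrite /= coef_poly im coef0 (negPf ai).
have qx : \sum_(i < size q) (q`_i)%:~R * x ^+ i = 0 :> K.
  have := @horner_coef_wide _ (\dim {:K}).+1 (map_poly intr q) x.
  rewrite size_map_poly_id0 ?intrK_eq0 ?lead_coef_eq0 // size_poly => /(_ isT).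
  rewrite horner_coef size_map_poly_id0 ?intrK_eq0 ?lead_coef_eq0 // => E.
  rewrite -[RHS]a0; transitivity (\sum_(i < size q) (map_poly intr q)`_i * x ^+ i).
    by apply: eq_bigr => j _; rewrite coef_map.
  by rewrite E; apply: eq_bigr => j _; rewrite coef_map coef_poly ltn_ord.
exists (lead_coef q); first by rewrite lead_coef_eq0.
have l0 : lead_coef q != 0 by rewrite lead_coef_eq0.
have szq : (0 < size q)%N by rewrite size_poly_gt0.
move: qx l0; rewrite lead_coefE; case: (size q) szq => // n _ /= qx ln0.
rewrite big_ord_recr /= in qx; set l := q`_n in qx ln0 *.
(* Monic, with r(l x) = l ^ (n - 1) q(x) = 0. The case n = 0 is excluded, as q(x) would then be the
   nonzero constant l. *)
pose r : {poly K} := 'X^n + \poly_(i < n) ((q`_i * l ^+ (n.-1 - i))%:~R).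
have szr : (size (\poly_(i < n) ((q`_i * l ^+ (n.-1 - i))%:~R : K)) < n.+1)%N.
  by rewrite ltnS size_poly.
apply: (@integral_root_monic _ _ intr _ r).
- by rewrite monicE lead_coefDl ?size_polyXn // lead_coefXn.
- rewrite /root hornerD hornerXn horner_poly exprMn.
  case: n @l r qx {szr} ln0 => [|n] l r qx l0.
    by move/eqP: qx; rewrite big_ord0 add0r mulr1 intrK_eq0 (negPf l0).
  rewrite exprSr -mulrA.
  apply/eqP; transitivity (l%:~R ^+ n * (\sum_(i < n.+1) (q`_i)%:~R * x ^+ i + l%:~R * x ^+ n.+1)).
    2: by rewrite qx mulr0.
  rewrite mulrDr addrC mulr_sumr; congr (_ + _).
  apply: eq_bigr => j _; rewrite exprMn intrM rmorphXn /=.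
  rewrite [RHS]mulrCA -[LHS]mulrA; congr (_ * _).
  by rewrite mulrA -exprD subnK // -ltnS.
- apply/integral_poly => j; rewrite coefD coefXn coef_poly.
  apply: OKD; first exact: OK_nat.
  by case: ifP => _; [exact: OK_int|exact: OK0].
Qed.
End AlgebraicIntegers.

(** * Finiteness of the ring of integers modulo p *)

Section FiniteQuotient.
Variable K : fieldExtType rat.
Implicit Types (x y a b c : K) (p : nat).

Definition OKdvd c x := exists2 b, OK b & x = c * b.

Lemma OKdvdD c x y : OKdvd c x -> OKdvd c y -> OKdvd c (x + y).
Proof.
by move=> [b Ob ->] [b' Ob' ->]; exists (b + b'); [exact: OKD|rewrite mulrDr].
Qed.

Lemma OKdvdN c x : OKdvd c x -> OKdvd c (- x).
Proof. by move=> [b Ob ->]; exists (- b); [exact: OKN|rewrite mulrN]. Qed.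

Lemma OKdvdMl c a x : OK a -> OKdvd c x -> OKdvd c (a * x).
Proof.
by move=> Oa [b Ob ->]; exists (a * b); [exact: OKM|rewrite mulrCA].
Qed.

Lemma OKdvd0 c : OKdvd c 0.
Proof. by exists 0; rewrite ?mulr0 //; apply: OK0. Qed.

Lemma OKdvd_sum c (I : eqType) (r : seq I) (F : I -> K) :
  (forall i, i \in r -> OKdvd c (F i)) -> OKdvd c (\sum_(i <- r) F i).
Proof.
by move=> OF; rewrite big_seq; apply: big_ind => //; [exact: OKdvd0|exact: OKdvdD].
Qed.

Lemma natK_neq0 n : (0 < n)%N -> n%:R != 0 :> K.
Proof. by move=> n0; rewrite -[n%:R]/(Posz n)%:~R intrK_eq0 -[0]/(Posz 0) eqz_nat -lt0n. Qed.

Lemma prime_Bezout p (z : int) : prime p -> ~~ (p%:Z %| z)%Z ->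
  exists u v : int, u * z + v * p%:Z = 1.
Proof.
move=> pp nz; have [u [v uv]] := Bezoutz z p%:Z; exists u, v; rewrite uv.
apply/eqP; rewrite -[_ == _]/(coprimez z p%:Z) coprimez_sym.
by rewrite coprimezE prime_coprime.
Qed.

(** A longest list whose classes are independent over Z/p generates the quotient by p;
    [primitive_dependence] bounds the length of such lists by [K : Q]. *)
Lemma OK_finite_mod p : prime p ->
  exists2 s : seq K, (forall y, y \in s -> OK y) &
    forall a, OK a -> exists2 y, y \in s & OKdvd p%:R (a - y).
Proof.
move=> pp.
pose indep (l : seq K) := (forall y, y \in l -> OK y) /\
  forall c : nat -> int, OKdvd p%:R (\sum_(i < size l) (c i)%:~R * l`_i) ->
    forall i, (i < size l)%N -> (p%:Z %| c i)%Z.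
have szle l : indep l -> (size l <= \dim {:K})%N.
  move=> [_ il]; rewrite leqNgt; apply/negP => lt.
  have [c c0 [i ilt /negP]] := primitive_dependence (nth 0 l) pp lt; apply.
  by apply: il => //; rewrite c0; apply: OKdvd0.
have ex0 : exists n, `[< exists2 l, indep l & size l = n >].
  by exists 0%N; apply/asboolP; exists [::].
have exb n : `[< exists2 l, indep l & size l = n >] -> (n <= \dim {:K})%N.
  by move=> /asboolP[l il <-]; apply: szle.
case: (ex_maxnP ex0 exb) => n /asboolP[l [lO il] sl] maxn.
(* Residues below p suffice as coefficients; the type ['I_p.+1] is there because [inord] needs a
   successor. *)
exists [seq \sum_(i < n) ((f : {ffun 'I_n -> 'I_p.+1}) i)%:R * l`_i | f : {ffun 'I_n -> 'I_p.+1}].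
  move=> y /mapP[f _ ->]; apply: OK_sum => i _; apply: OKM; first exact: OK_nat.
  by apply: lO; rewrite mem_nth // sl.
move=> a Oa.
have [c [i cP]] : exists c : nat -> int, exists i, [/\ (i <= n)%N, ~~ (p%:Z %| c i)%Z &
    OKdvd p%:R (\sum_(i < n) (c i)%:~R * l`_i + (c n)%:~R * a)].
  apply: contrapT => H.
  suff : (n.+1 <= n)%N by rewrite ltnn.
  apply: maxn; apply/asboolP; exists (rcons l a); last by rewrite size_rcons sl.
  split=> [y|c]; first by rewrite mem_rcons inE => /predU1P[->|/lO].
  rewrite size_rcons sl big_ord_recr /= nth_rcons sl ltnn eqxx => D i; rewrite ltnS => ile.
  apply: contrapT => /negP nd; apply: H; exists c, i; split => //.
  rewrite (_ : \sum_(i < n) _ = \sum_(i < n) (c i)%:~R * (rcons l a)`_i) //.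
  by apply: eq_bigr => j _; rewrite nth_rcons sl ltn_ord.
have [ile ni D] := cP.
(* If p divided [c n], the term in [a] would vanish modulo p, against the independence of [l]. So
   [c n] has an inverse u modulo p, and [a] is congruent to the combination with coefficients - u
   c_i. *)
have ncn : ~~ (p%:Z %| c n)%Z.
  apply: contra ni => cn; move: ile; rewrite leq_eqVlt => /predU1P[->//|ilt].
  apply: il; last by rewrite sl.
  rewrite sl; rewrite -[X in OKdvd _ X](addrK ((c n)%:~R * a)); apply: OKdvdD => //.
  apply: OKdvdN; have /dvdzP[q ->] := cn.
  by exists (q%:~R * a); [apply: OKM => //; exact: OK_int|rewrite intrM; ring].
have [u [v uv]] := prime_Bezout pp ncn.
pose f := [ffun i : 'I_n => inord `|((- (u * c i)) %% p%:Z)%Z|%N : 'I_p.+1].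
exists (\sum_(i < n) (f i)%:R * l`_i); first by apply/mapP; exists f; rewrite ?mem_enum.
have p0 : p%:Z != 0 by rewrite -[0]/(Posz 0) eqz_nat -lt0n prime_gt0.
have fE (j : 'I_n) : (f j)%:R = (- (u * c j) - (- (u * c j) %/ p%:Z)%Z * p%:Z)%:~R :> K.
  rewrite ffunE inordK; last first.
    by rewrite ltnS ltnW // -ltz_nat gez0_abs ?modz_ge0 // ltz_pmod // ltz_nat prime_gt0.
  rewrite -[LHS]/(Posz _)%:~R gez0_abs ?modz_ge0 //; congr (_%:~R).
have -> : a - \sum_(i < n) (f i)%:R * l`_i =
    u%:~R * (\sum_(i < n) (c i)%:~R * l`_i + (c n)%:~R * a) + p%:R * (v%:~R * a)
    + \sum_(i < n) p%:R * (((- (u * c i) %/ p%:Z)%Z)%:~R * l`_i).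
  transitivity ((u * c n + v * p%:Z)%:~R * a - \sum_(i < n) (f i)%:R * l`_i).
    by rewrite uv mul1r.
  rewrite intrD !intrM !mulrDr !mulr_sumr mulrDl.
  rewrite -sumrN -!addrA [RHS]addrC -!addrA [RHS]addrC -!addrA.
  have -> : \sum_(i < n) - ((f i)%:R * l`_i) =
     \sum_(i < n) u%:~R * ((c i)%:~R * l`_i) +
     \sum_(i < n) p%:R * ((- (u * c i) %/ p%:Z)%Z%:~R * l`_i).
    rewrite -big_split /=; apply: eq_bigr => j _; rewrite fE intrB intrN !intrM.
    by rewrite -[p%:Z%:~R]/(p%:R); ring.
  by rewrite -[p%:Z%:~R]/(p%:R); ring.
apply: OKdvdD; last first.
  apply: OKdvd_sum => j _; exists ((- (u * c j) %/ p%:Z)%Z%:~R * l`_j) => //.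
  by apply: OKM; [exact: OK_int|apply: lO; rewrite mem_nth // sl].
apply: OKdvdD; first by apply: OKdvdMl => //; exact: OK_int.
by exists (v%:~R * a) => //; apply: OKM => //; exact: OK_int.
Qed.

Lemma OK_pigeonhole p (g : nat -> K) : prime p -> (forall i, OK (g i)) ->
  exists i j, (i < j)%N /\ OKdvd p%:R (g i - g j).
Proof.
move=> pp Og; have [s sO srep] := OK_finite_mod pp.
have /choice[h hP] : forall i, exists y, y \in s /\ OKdvd p%:R (g i - y).
  by move=> i; have [y] := srep _ (Og i); exists y.
have /(uniqPn 0)[i [j [ij jlt hij]]] : ~~ uniq [seq h i | i <- iota 0 (size s).+1].
  apply/negP => U.
  have : (size [seq h i | i <- iota 0 (size s).+1] <= size s)%N.
    by apply: (uniq_leq_size U) => _ /mapP[i _ ->]; have [] := hP i.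
  by rewrite size_map size_iota ltnn.
exists i, j; split => //; move: hij jlt; rewrite size_map size_iota => hij jlt.
have ilt := ltn_trans ij jlt.
rewrite !(nth_map 0%N) ?size_iota // !nth_iota // in hij.
rewrite (_ : _ - _ = (g i - h i) + - (g j - h j)).
  by apply: OKdvdD; [have [] := hP i|apply: OKdvdN; have [] := hP j].
by rewrite hij; ring.
Qed.

End FiniteQuotient.

(** * A single prime: residue field and local generator *)

Section Prime.
Variables (K : fieldExtType rat) (P : set K).
Hypothesis primeP : nzprime P.
Implicit Types (x y a b c u w : K) (p : nat).

Lemma nzprime_OK x : P x -> OK x.
Proof. by case: primeP => -[[h _ _ _] _] _ _; apply: h. Qed.

Lemma nzprime0 : P 0.
Proof. by case: primeP => -[[]]. Qed.

Lemma nzprimeD x y : P x -> P y -> P (x + y).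
Proof. by case: primeP => -[[_ _ h _] _] _ _; apply: h. Qed.

Lemma nzprimeMl a x : OK a -> P x -> P (a * x).
Proof. by case: primeP => -[[_ _ _ h] _] _ _; apply: h. Qed.

Lemma nzprimeMr a x : OK a -> P x -> P (x * a).
Proof. by rewrite mulrC; apply: nzprimeMl. Qed.

Lemma nzprimeN x : P x -> P (- x).
Proof. by rewrite -mulN1r; apply/nzprimeMl/OKN/OK1. Qed.

Lemma nzprimeB x y : P x -> P y -> P (x - y).
Proof. by move=> Px Py; apply: nzprimeD => //; apply: nzprimeN. Qed.

Lemma nzprime1 : ~ P 1.
Proof. by case: primeP. Qed.

Lemma nzprime_mul x y : OK x -> OK y -> P (x * y) -> P x \/ P y.
Proof. by case: primeP => _ _; apply. Qed.

Lemma nzprime_notinM x y : OK x -> OK y -> ~ P x -> ~ P y -> ~ P (x * y).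
Proof. by move=> Ox Oy nx ny /(nzprime_mul Ox Oy)[]. Qed.

Lemma nzprime_notinX x n : OK x -> ~ P x -> ~ P (x ^+ n).
Proof.
move=> Ox nx; elim: n => [|n IH]; first exact: nzprime1.
by rewrite exprS; apply: nzprime_notinM => //; apply: OKX.
Qed.

Lemma nzprimeX x n : P x -> (0 < n)%N -> P (x ^+ n).
Proof.
by case: n => // n Px _; rewrite exprSr; apply: nzprimeMl => //; apply/OKX/nzprime_OK.
Qed.

Lemma nzprime_sum (I : eqType) (r : seq I) (F : I -> K) :
  (forall i, i \in r -> P (F i)) -> P (\sum_(i <- r) F i).
Proof.
by move=> OF; rewrite big_seq; apply: big_ind => //; [exact: nzprime0|exact: nzprimeD].
Qed.

Lemma OKdvd_nzprime c x : P c -> OKdvd c x -> P x.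
Proof. by move=> Pc [b Ob ->]; apply: nzprimeMr. Qed.

(** A nonzero x in P divides a nonzero integer, which therefore lies in P; as P is prime, so does
    one of its prime factors. *)
Lemma ex_prime_nzprime : exists2 p, prime p & P p%:R.
Proof.
have [x Px x0] : exists2 x, P x & x != 0 by case: primeP => -[].
have [z z0 [b Ob zE]] := OK_dvd_int (nzprime_OK Px) x0.
have : P (`|z|%N)%:R.
  have Pz : P z%:~R by rewrite zE; apply: nzprimeMr.
  by move: Pz; case: (z) => n // /nzprimeN; rewrite NegzE intrN opprK.
have : (0 < `|z|)%N by rewrite absz_gt0.
elim/ltn_ind: `|z|%N => n IH n0 Pn.
have [n1|n1] := leqP n 1.
  by case: nzprime1; rewrite (_ : 1 = n%:R) // (eqP (_ : n == 1%N)) // eqn_leq n1.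
have pn := pdiv_prime n1; have /dvdnP[q qE] := pdiv_dvd n.
have q0 : (0 < q)%N by move: n0; rewrite qE muln_gt0 => /andP[].
have : P (q%:R * (pdiv n)%:R) by rewrite -natrM -qE.
move=> /(nzprime_mul (OK_nat _ _) (OK_nat _ _))[Pq|Pp]; last by exists (pdiv n).
apply: (IH q) => //; rewrite qE ltn_Pmulr // prime_gt1 //.
Qed.

Section Over.
Variable p : nat.
Hypotheses (pp : prime p) (Pp : P p%:R).

Lemma nzprime_int (z : int) : P z%:~R -> (p%:Z %| z)%Z.
Proof.
move=> Pz; apply: contrapT => /negP /(prime_Bezout pp)[u [v uv]].
apply: nzprime1; rewrite -[1]/(1%:~R) -uv intrD !intrM.
by apply: nzprimeD; apply: nzprimeMl => //; apply: OK_int.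
Qed.

(** Two powers of u agree modulo p, so P contains u ^ i (1 - u ^ (j - i)), hence the second factor:
    u ^ (j - i - 1) inverts u modulo P. *)
Lemma nzprime_maximal u : OK u -> ~ P u -> exists2 c, OK c & P (1 - u * c).
Proof.
move=> Ou nu; have [i [j [ij /(OKdvd_nzprime Pp)]]] :=
  OK_pigeonhole pp (fun i => OKX i Ou).
rewrite -(subnKC ij) addSn -addnS exprD -{1}[u ^+ i]mulr1 -mulrBr.
move=> /nzprime_mul[||/(nzprime_notinX Ou nu)//|]; first exact: OKX.
  by apply: OKB; [exact: OK1|exact: OKX].
by rewrite exprS; exists (u ^+ (j - i.+1)) => //; apply: OKX.
Qed.

Lemma finite_cosets : finite_set (cosets P).
Proof.
have [s sO srep] := OK_finite_mod K pp.
apply: (sub_finite_set _ (finite_image (fun x => [set x + y | y in P]) (finite_seq s))).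
move=> _ [x Ox <-]; have [y ys /(OKdvd_nzprime Pp) Pxy] := srep _ Ox.
exists y => //; apply/seteqP; split => _ [z Pz <-] /=.
  by exists (z - (x - y)); [exact: nzprimeB|ring].
by exists (z + (x - y)); [exact: nzprimeD|ring].
Qed.

(** The integers 0, ..., p - 1 lie in distinct cosets. Finiteness of [cosets P] matters here, since
    [fset_set] sends an infinite set to the empty one. *)
Lemma leq_idnorm : (p <= idnorm P)%N.
Proof.
pose co (x : K) : set K := [set x + y | y in P].
have U : uniq [seq co i%:R | i <- iota 0 p].
  rewrite map_inj_in_uniq ?iota_uniq // => i j; rewrite !mem_iota !add0n /= => ip jp E.
  have : co j%:R i%:R by rewrite -E; exists 0; [exact: nzprime0|rewrite addr0].
  case=> y Py yE; have : P (i%:Z - j%:Z)%:~R.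
    by rewrite intrB -[i%:Z%:~R]/(i%:R) -yE -[j%:Z%:~R]/(j%:R) addrAC subrr add0r.
  move=> /nzprime_int; rewrite -eqz_mod_dvd !modz_nat eqz_nat.
  by rewrite !modn_small // => /eqP.
rewrite /idnorm -{1}(size_iota 0 p) -(size_map (fun i => co i%:R)).
apply: (uniq_leq_size U) => _ /mapP[i _ ->].
rewrite in_fset_set ?inE; last exact: finite_cosets.
by exists i%:R => //; apply: OK_nat.
Qed.

(* Two powers of [y] in [P] agree modulo [p], so some [1 - y ^+ m], which is not
   in [P], kills a power of [y] modulo [p].  Multiplying a product of such elements
   by maximal nonkilled powers of representatives of [P] yields [b]. *)
Lemma ex_annihilator_mod : exists2 b, OK b & ~ OKdvd p%:R b /\
  forall y, P y -> OKdvd p%:R (b * y).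
Proof.
have Op := OK_nat K p.
have [s sO srep] := OK_finite_mod K pp.
have nil y : P y -> exists w n, [/\ OK w, ~ P w & OKdvd p%:R (w * y ^+ n)].
  move=> Py; have Oy := nzprime_OK Py.
  have [i [j [ij D]]] := OK_pigeonhole pp (fun i => OKX i Oy).
  exists (1 - y ^+ (j - i)), i; split.
  - by apply: OKB; [exact: OK1|exact: OKX].
  - move=> H; apply: nzprime1; rewrite -[1](subrK (y ^+ (j - i))).
    by apply: nzprimeD => //; apply: nzprimeX => //; rewrite subn_gt0.
  - by rewrite mulrBl mul1r -exprD subnK // ltnW.
have nils (t : seq K) : (forall y, y \in t -> P y) -> exists2 w, OK w &
    ~ P w /\ forall y, y \in t -> exists n, OKdvd p%:R (w * y ^+ n).
  elim: t => [|y t IH] Pt; first by exists 1; [exact: OK1|split => //; exact: nzprime1].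
  have [|w Ow [nw wt]] := IH; first by move=> z zt; apply: Pt; rewrite inE zt orbT.
  have [w' [n [Ow' nw' D]]] := nil y (Pt _ (mem_head _ _)).
  exists (w' * w); first exact: OKM.
  split; first exact: nzprime_notinM.
  move=> z; rewrite inE => /predU1P[->|/wt[m Dm]].
    by exists n; rewrite mulrAC mulrC; apply: OKdvdMl.
  by exists m; rewrite -mulrA; apply: OKdvdMl.
have kill (t : seq K) b : (forall y, y \in t -> OK y) -> OK b -> ~ OKdvd p%:R b ->
    (forall y, y \in t -> exists n, OKdvd p%:R (b * y ^+ n)) ->
    exists2 c, OK c & ~ OKdvd p%:R (b * c) /\
      forall y, y \in t -> OKdvd p%:R (b * c * y).
  elim: t b => [|y t IH] b Ot Ob nb bt.
    by exists 1; [exact: OK1|rewrite mulr1].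
  have Oy := Ot y (mem_head _ _).
  have ex : exists n, `[< OKdvd p%:R (b * y ^+ n) >].
    by have [n D] := bt y (mem_head _ _); exists n; apply/asboolP.
  case: (ex_minnP ex) => -[|n] /asboolP D minn.
    by case: nb; rewrite -[b]mulr1 -(expr0 y).
  have nD : ~ OKdvd p%:R (b * y ^+ n).
    by move=> /asboolP /minn; rewrite ltnn.
  have [||//||c Oc [nc ct]] := IH (b * y ^+ n).
  - by move=> z zt; apply: Ot; rewrite inE zt orbT.
  - by apply: OKM => //; apply: OKX.
  - move=> z zt; have [|m Dm] := bt z; first by rewrite inE zt orbT.
    by exists m; rewrite mulrAC mulrC; apply: OKdvdMl => //; apply: OKX.
  exists (y ^+ n * c); first by apply: OKM => //; apply: OKX.
  rewrite mulrA; split => // z; rewrite inE => /predU1P[->|/ct//].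
  rewrite (_ : _ * _ = c * (b * y ^+ n.+1)); first exact: OKdvdMl.
  by rewrite exprS; ring.
have [|w Ow [nw wt]] := nils [seq y <- s | `[< P y >]].
  by move=> y; rewrite mem_filter => /andP[/asboolP].
have [||c Oc [nc ct]] := kill [seq y <- s | `[< P y >]] w _ Ow _ wt.
- by move=> y; rewrite mem_filter => /andP[_ /sO].
- by move=> /(OKdvd_nzprime Pp).
exists (w * c); first exact: OKM.
split => // y Py; have [r rs D] := srep _ (nzprime_OK Py).
rewrite -[y](subrK r) mulrDr; apply: OKdvdD; first by apply: OKdvdMl => //; exact: OKM.
apply: ct; rewrite mem_filter rs andbT; apply/asboolP.
by rewrite -[r](subKr y); apply: nzprimeB => //; apply: OKdvd_nzprime D.
Qed.

(* Multiplication by [g] inverts [P] locally. *)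
Lemma ex_uniformizer : exists t g, [/\ P t, ~ P (g * t), OK (g * t) &
  forall y, P y -> OK (g * y)].
Proof.
have [b Ob [nb bP]] := ex_annihilator_mod.
have pK : p%:R != 0 :> K by apply/natK_neq0/prime_gt0.
pose g := b / p%:R.
have gP y : P y -> OK (g * y).
  by move=> /bP[c Oc E]; rewrite /g mulrAC E mulrC mulrA mulVf ?mul1r.
have ngO : ~ OK g.
  by move=> Og; apply: nb; exists g => //; rewrite /g mulrC divfK.
suff : ~ forall y, P y -> P (g * y).
  move=> /existsNP[t /not_implyP[Pt nt]]; exists t, g; split => //; exact: gP.
move=> stab; apply: ngO.
have Pg n : P (p%:R * g ^+ n).
  by elim: n => [|n IH]; rewrite ?mulr1 // exprS mulrCA; apply: stab.
have [i [j [ij [e Oe]]]] := OK_pigeonhole pp (fun n => nzprime_OK (Pg n)).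
rewrite -mulrBr => /(mulfI pK) E.
(* As i < j this polynomial is monic, and it vanishes at g, so g would be integral. *)
apply: (@integral_root_monic _ _ intr _ ('X^j - ('X^i - e%:P))).
- rewrite monicE lead_coefDl ?lead_coefXn // size_polyN size_polyXn ltnS.
  apply: leq_trans (size_polyD _ _) _; rewrite geq_max size_polyXn size_polyN ij.
  exact: leq_trans (size_polyC_leq1 _) (leq_trans _ ij).
- by rewrite /root !hornerE -E; apply/eqP; ring.
- apply/integral_poly => k; rewrite !coefB !coefXn coefC.
  apply: OKB; first exact: OK_nat.
  by apply: OKB; [exact: OK_nat|case: ifP => _ //; exact: OK0].
Qed.

End Over.
End Prime.

(** * The valuation at P, through the localization *)

Section Valuation.
Variables (K : fieldExtType rat) (P : set K).
Hypothesis primeP : nzprime P.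
Variables (p : nat) (t g : K).
Hypotheses (pp : prime p) (Pp : P p%:R).
Hypotheses (Pt : P t) (ngt : ~ P (g * t)) (Ogt : OK (g * t)).
Hypothesis gP : forall y, P y -> OK (g * y).
Implicit Types (x y z a b c u w : K) (m n : int).

(* In the localization of [OK] at [P], [local_ge n z] says that [z] lies in
   [t ^ n OK_P] and [local_eq n z] that it generates this fractional ideal. *)
Definition local_ge n z :=
  exists w a, [/\ OK w, ~ P w, OK a & w * z = t ^ n * a].

Definition local_eq n z :=
  exists w a, [/\ OK w, ~ P w, OK a, ~ P a & w * z = t ^ n * a].

Let Ot : OK t := nzprime_OK primeP Pt.

Lemma uniformizer_neq0 : t != 0.
Proof. by apply/eqP => t0; apply: ngt; rewrite t0 mulr0; apply: nzprime0. Qed.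

Let tz n : t ^ n != 0 := expfz_neq0 n uniformizer_neq0.
Let tD m n : t ^ (m + n) = t ^ m * t ^ n := expfzDr m n uniformizer_neq0.

Lemma local_geW n z : local_eq n z -> local_ge n z.
Proof. by move=> [w [a [Ow nw Oa na E]]]; exists w, a. Qed.

(** If a lies in P, multiplying w z = t ^ n a by g t, which is outside P, gives (g t w) z = t ^ (n +
    1) (g a) with g a integral. *)
Lemma local_ge_eq n z : local_ge n z -> local_eq n z \/ local_ge (n + 1) z.
Proof.
move=> [w [a [Ow nw Oa E]]]; have [Pa|na] := pselect (P a); last by left; exists w, a.
right; exists (g * t * w), (g * a); split.
- exact: OKM.
- exact: nzprime_notinM.
- exact: gP.
- by rewrite -mulrA E tD expr1z; ring.
Qed.

(** For n < m, cross-multiplying the two equations gives a w' = w b t ^ (m - n), which puts a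
    product of elements outside P into P. *)
Lemma local_eq_ge n m z : local_eq n z -> local_ge m z -> (m <= n)%R.
Proof.
move=> [w [a [Ow nw Oa na E]]] [w' [b [Ow' nw' Ob E']]]; rewrite leNgt; apply/negP => nm.
have /nzprime_notinM H := na; have := H primeP w' Oa Ow' nw'; apply.
have -> : a * w' = w * b * t ^ (m - n).
  apply: (mulfI (tz n)); rewrite mulrA -E.
  transitivity (w * b * t ^ (n + (m - n))); last by rewrite tD; ring.
  rewrite addrCA subrr addr0 (_ : w * b * _ = w * (t ^ m * b)); last by ring.
  by rewrite -E'; ring.
apply: nzprimeMl => //; first exact: OKM.
have : (0 < m - n) by rewrite subr_gt0.
by case: (m - n) => // k k0; rewrite -exprnP; apply: nzprimeX.
Qed.

Lemma local_eq_uniq n m z : local_eq n z -> local_eq m z -> m = n.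
Proof.
move=> En Em; apply: le_anti.
by rewrite (local_eq_ge En (local_geW Em)) (local_eq_ge Em (local_geW En)).
Qed.

Lemma local_eqM m n x y : local_eq m x -> local_eq n y -> local_eq (m + n) (x * y).
Proof.
move=> [w [a [Ow nw Oa na E]]] [w' [b [Ow' nw' Ob nb E']]].
exists (w * w'), (a * b); split; [exact: OKM|exact: nzprime_notinM|exact: OKM| |].
  exact: nzprime_notinM.
by rewrite tD mulrACA E E'; ring.
Qed.

Lemma local_eq_div m n x y : y != 0 -> local_eq m x -> local_eq n y -> local_eq (m - n) (x / y).
Proof.
move=> y0 [w [a [Ow nw Oa na E]]] [w' [b [Ow' nw' Ob nb E']]].
exists (w * b), (a * w'); split; [exact: OKM|exact: nzprime_notinM|exact: OKM| |].
  exact: nzprime_notinM.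
apply: (mulIf y0); apply: (mulfI (tz n)).
transitivity (w * x * (t ^ n * b) * (y / y)); first by ring.
rewrite divff // mulr1 E -E'.
transitivity (t ^ (n + (m - n)) * a * w' * y); last by rewrite tD; ring.
by rewrite addrCA subrr addr0; ring.
Qed.

Lemma local_geM m n x y : local_ge m x -> local_ge n y -> local_ge (m + n) (x * y).
Proof.
move=> [w [a [Ow nw Oa E]]] [w' [b [Ow' nw' Ob E']]].
exists (w * w'), (a * b); split; [exact: OKM|exact: nzprime_notinM|exact: OKM|].
by rewrite tD mulrACA E E'; ring.
Qed.

Lemma local_geD n x y : local_ge n x -> local_ge n y -> local_ge n (x + y).
Proof.
move=> [w [a [Ow nw Oa E]]] [w' [b [Ow' nw' Ob E']]].
exists (w * w'), (a * w' + b * w); split; [exact: OKM|exact: nzprime_notinM| |].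
  by apply: OKD; apply: OKM.
transitivity (w * x * w' + w' * y * w); first by ring.
by rewrite E E'; ring.
Qed.

Lemma local_ge0 n : local_ge n 0.
Proof.
by exists 1, 0; rewrite !mulr0; split => //; [exact: OK1|exact: nzprime1|exact: OK0].
Qed.

Lemma local_ge_OK a : OK a -> local_ge 0 a.
Proof.
by move=> Oa; exists 1, a; rewrite expr0z; split => //; [exact: OK1|exact: nzprime1].
Qed.

Lemma local_eq_notin a : OK a -> ~ P a -> local_eq 0 a.
Proof.
by move=> Oa na; exists 1, a; rewrite expr0z; split => //; [exact: OK1|exact: nzprime1].
Qed.

Lemma local_ge_prime y : P y -> local_ge 1 y.
Proof.
by move=> Py; exists (g * t), (g * y); split => //; [exact: gP|rewrite expr1z; ring].
Qed.

Lemma local_ge_le m n z : m <= n -> local_ge n z -> local_ge m z.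
Proof.
move=> mn [w [a [Ow nw Oa E]]]; exists w, (t ^ (n - m) * a); split => //.
  have : (0 <= n - m) by rewrite subr_ge0.
  by case: (n - m) => // k _; apply: OKM => //; rewrite -exprnP; apply: OKX.
by rewrite E mulrA -tD addrCA subrr addr0.
Qed.

Lemma local_eqX (k : nat) n z : local_eq n z -> local_eq (n *+ k) (z ^+ k).
Proof.
move=> E; elim: k => [|k IH]; last by rewrite mulrS exprS; apply: local_eqM.
by apply: local_eq_notin; [exact: OK1|exact: nzprime1].
Qed.

Lemma local_eq_uniformizer : local_eq 1 t.
Proof.
exists 1, 1; rewrite expr1z mulrC; split => //; try exact: OK1; exact: nzprime1.
Qed.

(* A dependence of [1, t, ..., t ^ \dim K] with a coefficient prime to [p]
   would be violated if [p] were divisible by a higher power of [t]. *)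
Lemma local_ge_bound n : local_ge n p%:R -> n <= (\dim {:K})%:Z.
Proof.
move=> H; rewrite leNgt; apply/negP => dn.
have {dn H} : local_ge (\dim {:K}).+1 p%:R.
  by apply: local_ge_le H; rewrite -addn1 PoszD lezD1.
set d := \dim {:K} => -[w [b [Ow nw Ob E]]].
have [a a0 exa] := primitive_dependence (fun i => t ^+ i) pp (ltnSn d).
clearbody d.
(* Take j least with [a j] prime to p. After multiplication by w, the terms before j are divisible
   by w p, hence by t ^ (d + 1), and those after j by t ^ (j + 1). So t divides w a_j, although w
   and a_j lie outside P. *)
have ex : exists j, (j < d.+1)%N && ~~ (p%:Z %| a j)%Z.
  by have [j jd nj] := exa; exists j; rewrite jd.
case: (ex_minnP ex) => j /andP[jd nj] minj.
have aj : ~ P (a j)%:~R by move=> /(nzprime_int primeP pp Pp); apply/negP.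
suff : P (w * (a j)%:~R) by apply: nzprime_notinM => //; apply: OK_int.
suff [e Oe eE] : OKdvd (t ^+ j.+1) (w * (a j)%:~R * t ^+ j).
  have tj : t ^+ j != 0 by rewrite expf_neq0 // uniformizer_neq0.
  have -> : w * (a j)%:~R = t * e.
    by apply: (mulIf tj); rewrite eE exprS; ring.
  exact: nzprimeMr.
have -> : w * (a j)%:~R * t ^+ j =
    - \sum_(i < d.+1 | i != Ordinal jd) w * ((a i)%:~R * t ^+ i).
  apply/eqP; rewrite -addr_eq0 -mulr_sumr -mulrA -mulrDr; apply/eqP.
  transitivity (w * (\sum_(i < d.+1) (a i)%:~R * t ^+ i)); last by rewrite a0 mulr0.
  by rewrite [in RHS](bigD1 (Ordinal jd)).
apply: OKdvdN; rewrite big_mkcond; apply: OKdvd_sum => i _.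
case: ifP => [|_]; last exact: OKdvd0.
rewrite -val_eqE neq_ltn /= => /orP[ij|ji].
- have /dvdzP[q ->] : (p%:Z %| a i)%Z.
    apply: contrapT => /negP ni; have := minj i; rewrite ltn_ord ni => /(_ isT).
    by rewrite leqNgt ij.
  exists (t ^+ (d - j) * b * q%:~R * t ^+ i).
    by do !apply: OKM => //; try apply: OKX => //; exact: OK_int.
  transitivity (w * p%:R * (q%:~R * t ^+ i)); first by rewrite intrM -[p%:Z%:~R]/(p%:R); ring.
  have td : t ^+ d.+1 = t ^+ j.+1 * t ^+ (d - j) by rewrite -exprD addSn subnKC.
  by rewrite E -exprnP td; move: (t ^+ (d - j)) (t ^+ j.+1) (t ^+ i) => ? ? ?; ring.
- exists (w * (a i)%:~R * t ^+ (i - j.+1)).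
    by do !apply: OKM => //; try apply: OKX => //; exact: OK_int.
  have -> : t ^+ i = t ^+ j.+1 * t ^+ (i - j.+1) by rewrite -exprD subnKC.
  move: (t ^+ (i - j.+1)) (t ^+ j.+1) => ? ?; ring.
Qed.

(** Either z generates t ^ N OK_P or N can be raised by one, and the bound leaves at most k such
    steps. *)
Lemma local_eq_of_bounded (k : nat) z N : local_ge N z ->
  (forall n, local_ge n z -> n <= N + k%:Z) -> exists n, local_eq n z.
Proof.
elim: k N => [|k IH] N gN bd.
  have [E|/bd] := local_ge_eq gN; first by exists N.
  by rewrite lerD2l.
have [E|gN1] := local_ge_eq gN; first by exists N.
by apply: IH gN1 _ => n /bd; rewrite -addrA -[1]/(Posz 1) -PoszD add1n.
Qed.

(** In turn for p, by [local_ge_bound]; for positive integers, whose prime-to-p part lies outside P;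
    for a in OK, whose exponent is bounded by that of a nonzero integer multiple of a; and for
    quotients by an integer. *)
Lemma local_eq_ex z : z != 0 -> exists n, local_eq n z.
Proof.
have [e pe] : exists e, local_eq e p%:R.
  apply: (@local_eq_of_bounded (\dim {:K}) _ 0); first exact/local_ge_OK/OK_nat.
  by move=> n /local_ge_bound; rewrite add0r.
have nat_ex (k : nat) : (0 < k)%N -> exists n, local_eq n k%:R.
  move=> k0; have [m cop ->] := pfactor_coprime pp k0.
  rewrite natrM natrX; exists (0 + e *+ logn p k); apply: local_eqM.
    apply: local_eq_notin; first exact: OK_nat.
    move=> /(@nzprime_int _ _ primeP _ pp Pp m%:Z).
    by apply/negP; rewrite -[(_ %| _)%Z]/(p %| m)%N -prime_coprime.
  exact: local_eqX.
have OK_ex a : OK a -> a != 0 -> exists n, local_eq n a.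
  move=> Oa a0; have [N N0 [b Ob NE]] := OK_dvd_int Oa a0.
  have [n nE] := nat_ex `|N|%N (eq_ind_r is_true N0 (absz_gt0 N)).
  apply: (@local_eq_of_bounded `|n|%N _ 0); first exact: local_ge_OK.
  move=> k ka; rewrite add0r; apply: le_trans (lez_abs _); apply: (local_eq_ge nE).
  have -> : (`|N|%N)%:R = (Num.sg N)%:~R * b * a.
    rewrite mulrAC -mulrA -NE -intrM -[_%:R]/(Posz _)%:~R abszE.
    by rewrite [in LHS]normrEsg.
  by rewrite -[k]add0r; apply: local_geM => //; apply: local_ge_OK; apply: OKM => //; exact: OK_int.
move=> z0; have [N N0 ONz] := int_mul_OK z.
have NK : N%:~R != 0 :> K by rewrite intrK_eq0.
have [n nE] := OK_ex _ ONz (mulf_neq0 NK z0).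
have [m mE] := OK_ex _ (OK_int _ N) NK.
exists (n - m); rewrite (_ : z = N%:~R * z / N%:~R); first exact: local_eq_div.
by rewrite mulrAC divff // mul1r.
Qed.

Lemma ideal_exp_is_ideal k : is_ideal (@OK K) (ideal_exp P k).
Proof.
elim: k => [|k [IO I0 ID IM]].
  by split => //; [exact: OK0|exact: OKD|exact: OKM].
split => /=.
- move=> _ [s sP ->]; apply: OK_sum => u /sP[Pu Iu].
  by apply: OKM; [exact: nzprime_OK Pu|exact: IO].
- by exists [::] => //; rewrite big_nil.
- move=> _ _ [s sP ->] [s' sP' ->]; exists (s ++ s'); last by rewrite big_cat.
  by move=> u; rewrite mem_cat => /orP[/sP|/sP'].
- move=> a _ Oa [s sP ->]; exists [seq (a * u.1, u.2) | u : K * K <- s].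
    by move=> _ /mapP[u /sP[Pu Iu] ->]; split => //=; apply: nzprimeMl.
  by rewrite big_map mulr_sumr; apply: eq_bigr => u _; rewrite mulrA.
Qed.

Lemma ideal_expS k x y : P x -> ideal_exp P k y -> ideal_exp P k.+1 (x * y).
Proof.
move=> Px Iy; exists [:: (x, y)]; last by rewrite big_seq1.
by move=> u; rewrite inE => /eqP ->.
Qed.

Lemma ideal_expSW k : ideal_exp P k.+1 `<=` ideal_exp P k.
Proof.
move=> _ [s sP ->]; have [_ I0 ID IM] := ideal_exp_is_ideal k.
rewrite big_seq; apply: big_ind => // u /sP[Pu Iu]; apply: IM => //.
exact: nzprime_OK Pu.
Qed.

(** The power P ^ k is primary: choose c with 1 - w c in P and write a = c (w a) + (1 - w c) a. By
    induction a lies in P ^ (k - 1), so the last term lies in P ^ k. *)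
Lemma ideal_exp_cancel k w a : OK w -> ~ P w -> OK a ->
  ideal_exp P k (w * a) -> ideal_exp P k a.
Proof.
move=> Ow nw Oa; elim: k => [//|k IH] H.
have Ia := IH (ideal_expSW H); have [c Oc Pc] := nzprime_maximal primeP pp Pp Ow nw.
have [_ _ ID IM] := ideal_exp_is_ideal k.+1.
rewrite (_ : a = c * (w * a) + (1 - w * c) * a); last by ring.
by apply: ID; [exact: IM|exact: ideal_expS].
Qed.

(** P ^ k is the contraction of t ^ k OK_P to OK, which ties [ord_prime] to the local equations. *)
Lemma ideal_expP (k : nat) a : OK a -> ideal_exp P k a <-> local_ge k a.
Proof.
move=> Oa; split.
  elim: k a {Oa} => [|k IH] a; first exact: local_ge_OK.
  move=> [s sP ->]; rewrite big_seq; apply: big_ind.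
  - exact: local_ge0.
  - exact: local_geD.
  - move=> u /sP[Pu Iu]; rewrite -add1n PoszD; apply: local_geM.
      exact: local_ge_prime.
    exact: IH.
move=> [w [b [Ow nw Ob E]]]; apply: (ideal_exp_cancel Ow nw Oa); rewrite E.
elim: k {E} => [|k IH]; first by rewrite expr0z mul1r.
by rewrite -exprnP exprS -mulrA; apply: ideal_expS.
Qed.

Lemma ord_primeE a n : OK a -> local_eq n a -> (ord_prime P a)%:Z = n.
Proof.
move=> Oa E; have n0 := local_eq_ge E (local_ge_OK Oa).
case: n n0 E => // n _ E; congr Posz.
apply: xget_unique => [|k /= []].
  split; first exact/(ideal_expP _ Oa)/local_geW.
  by move=> /(ideal_expP _ Oa) /(local_eq_ge E); rewrite lez_nat ltnn.
move=> /(ideal_expP _ Oa) gk; have := local_eq_ge E gk; rewrite lez_nat => kn.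
move=> nk; apply/eqP; rewrite eqn_leq kn /= leqNgt; apply/negP => lt; apply: nk.
by apply/(ideal_expP k.+1 Oa); apply: local_ge_le (local_geW E).
Qed.

(** All quotients a / b representing x give the same difference n, and an integer denominator
    supplies one such quotient. *)
Lemma val_primeE x n : x != 0 -> local_eq n x -> val_prime P x = n%:E.
Proof.
move=> x0 E; rewrite /val_prime (negPf x0); congr (_%:E).
have H a b : OK a -> OK b -> a != 0 -> b != 0 -> x = a / b ->
   (ord_prime P a)%:Z - (ord_prime P b)%:Z = n.
  move=> Oa Ob a0 b0 xE.
  have [k kE] := local_eq_ex a0; have [l lE] := local_eq_ex b0.
  rewrite (ord_primeE Oa kE) (ord_primeE Ob lE); apply: (local_eq_uniq E).
  by rewrite xE; apply: local_eq_div.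
apply: xget_unique => [|k /= [a [b [[Oa Ob] [a0 b0] xE ->]]]]; last exact: H.
have [N N0 ONz] := int_mul_OK x.
have NK : N%:~R != 0 :> K by rewrite intrK_eq0.
have xE : x = N%:~R * x / N%:~R by rewrite mulrAC divff // mul1r.
exists (N%:~R * x), N%:~R; split => //; last first.
- by rewrite H //; [exact: OK_int|exact: mulf_neq0].
- by split => //; apply: mulf_neq0.
- by split => //; apply: OK_int.
Qed.

End Valuation.

(** * Summary of the valuation at a prime *)

Section ValPrime.
Variables (K : fieldExtType rat) (P : set K).
Hypothesis primeP : nzprime P.

(** From here on the choices of p, t and g are forgotten. The value of v at 0 is arbitrary, whence
    the conditions x != 0. *)
Lemma nzprime_valuation : exists v : K -> int,
  [/\ forall x, x != 0 -> val_prime P x = (v x)%:E,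
      forall x y, x != 0 -> y != 0 -> v (x * y) = v x + v y,
      forall x y n, x != 0 -> y != 0 -> x + y != 0 -> n <= v x -> n <= v y -> n <= v (x + y),
      forall x, OK x -> x != 0 -> 0 <= v x & 
      [/\ forall x, OK x -> ~ P x -> v x = 0,
        forall x, P x -> x != 0 -> 1 <= v x &
        exists2 t, OK t & t != 0 /\ v t = 1]].
Proof.
have [p pp Pp] := ex_prime_nzprime primeP.
have [t [g [Pt ngt Ogt gP]]] := ex_uniformizer primeP pp Pp.
have /choice[v vP] : forall x, exists n, x != 0 -> local_eq P t n x.
  move=> x; have [->|x0] := eqVneq x 0; first by exists 0.
  by have [n nE] := local_eq_ex primeP pp Pp Pt ngt Ogt gP x0; exists n.
have uni := local_eq_uniq primeP Pt ngt.
have t0 := uniformizer_neq0 primeP ngt.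
have geP x n : x != 0 -> local_ge P t n x <-> n <= v x.
  move=> x0; split; first exact: (local_eq_ge primeP Pt ngt (vP _ x0)).
  by move=> /(local_ge_le primeP Pt ngt); apply; apply/local_geW/vP.
exists v; split.
- by move=> x x0; apply: (val_primeE primeP pp Pp Pt ngt Ogt gP x0 (vP _ x0)).
- move=> x y x0 y0; apply: (uni _ _ (x * y)); last exact/vP/mulf_neq0.
  exact: (local_eqM primeP ngt (vP _ x0) (vP _ y0)).
- move=> x y n x0 y0 xy0 /(geP _ _ x0) gx /(geP _ _ y0) gy.
  exact/(geP _ _ xy0)/local_geD.
- by move=> x Ox x0; apply/(geP _ _ x0)/local_ge_OK.
- split.
    move=> x Ox nx; have x0 : x != 0 by apply/eqP => E; apply: nx; rewrite E; exact: nzprime0.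
    by apply: (uni _ _ x); [exact: local_eq_notin|exact: vP].
    by move=> x Px x0; apply/(geP _ _ x0); apply: local_ge_prime; eauto.
  exists t; first exact: nzprime_OK Pt.
  by split => //; apply: (uni _ _ t); [exact: local_eq_uniformizer|exact: vP].
Qed.

End ValPrime.

(** * Several primes, and ideals with prescribed valuations *)

Section Primes.
Variable K : fieldExtType rat.
Implicit Types (P Q : set K) (x y z : K).

(** Otherwise P contains Q, and an element of P outside Q is invertible modulo the maximal ideal Q,
    which puts 1 in P. *)
Lemma nzprime_separated P Q : nzprime P -> nzprime Q -> P <> Q ->
  exists2 y, Q y & ~ P y.
Proof.
move=> pP pQ PQ; apply: contrapT => H.
have QP : Q `<=` P by move=> y Qy; apply: contrapT => nP; apply: H; exists y.
apply: PQ; apply/seteqP; split => // u Pu; apply: contrapT => nQ.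
have [q pq Qq] := ex_prime_nzprime pQ.
have [c Oc /QP P1] := nzprime_maximal pQ pq Qq (nzprime_OK pP Pu) nQ.
apply: (nzprime1 pP); rewrite -[1](subrK (u * c)).
by apply: nzprimeD => //; apply: nzprimeMr.
Qed.

Lemma nzprime_avoidance P (s : seq (set K)) : nzprime P ->
  (forall Q, Q \in s -> nzprime Q /\ P <> Q) ->
  exists z, [/\ OK z, ~ P z & forall Q, Q \in s -> Q z].
Proof.
move=> pP; elim: s => [|Q s IH] sP.
  by exists 1; split => //; [exact: OK1|exact: nzprime1].
have [|z [Oz nz zs]] := IH; first by move=> Q' Q's; apply: sP; rewrite inE Q's orbT.
have [pQ PQ] := sP Q (mem_head _ _).
have [y Qy ny] := nzprime_separated pP pQ PQ; have Oy := nzprime_OK pQ Qy.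
exists (y * z); split; [exact: OKM|exact: nzprime_notinM|].
move=> Q'; rewrite inE => /predU1P[->|Q's]; first exact: nzprimeMr.
apply: nzprimeMl => //; last exact: zs.
by have [] := sP Q'; rewrite ?inE ?Q's ?orbT.
Qed.

(** Choose z_i in all the given primes but the i-th. In a dependence among the z_i, the i-th prime
    contains a_i z_i, hence a_i, so p divides every coefficient. With more than [K : Q] primes this
    contradicts [primitive_dependence]. *)
Lemma leq_size_nzprime_over p (s : seq (set K)) : prime p -> uniq s ->
  (forall P, P \in s -> nzprime P /\ P p%:R) -> (size s <= \dim {:K})%N.
Proof.
move=> pp us sP; rewrite leqNgt; apply/negP => lt.
have ex i : exists z, (i < size s)%N ->
    [/\ OK z, ~ nth set0 s i z & forall j, (j < size s)%N -> j != i -> nth set0 s j z].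
  have [ilt|_] := ltnP i (size s); last by exists 0.
  have [pP _] := sP _ (mem_nth set0 ilt).
  have [|z [Oz nz zs]] := @nzprime_avoidance _ [seq Q <- s | Q != nth set0 s i] pP.
    by move=> Q; rewrite mem_filter => /andP[/eqP nQ /sP[pQ _]]; split => // /esym.
  exists z => _; split => // j jlt ji; apply: zs.
  by rewrite mem_filter mem_nth // nth_uniq // ji.
have {ex}[z zP] := choice ex.
have [a a0 [i ilt /negP ni]] := primitive_dependence z pp lt; apply: ni.
have [Oz nz zs] := zP i ilt; have [pP Pp] := sP _ (mem_nth set0 ilt).
have : nth set0 s i ((a i)%:~R * z i).
  have -> : (a i)%:~R * z i = - \sum_(j < size s | j != Ordinal ilt) (a j)%:~R * z j.
    by apply/eqP; rewrite -addr_eq0 -{2}a0 [in X in _ == X](bigD1 (Ordinal ilt)).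
  apply: nzprimeN => //; rewrite big_mkcond; apply: nzprime_sum => // j _.
  case: ifP => [ji|_]; last exact: nzprime0.
  apply: nzprimeMl => //; first exact: OK_int.
  have [_ _] := zP j (ltn_ord j); apply => //.
  by apply: contra_neq ji => /esym E; apply: val_inj.
by move=> /(nzprime_mul pP (OK_int _ _) Oz)[/(nzprime_int pP pp Pp)|].
Qed.

Lemma nzprime_val_geD P x y (n : int) : nzprime P ->
  (n%:E <= val_prime P x -> n%:E <= val_prime P y -> n%:E <= val_prime P (x + y))%E.
Proof.
move=> pP; have [v [vE _ vD _ _]] := nzprime_valuation pP.
have [->|x0] := eqVneq x 0; first by rewrite add0r.
have [->|y0] := eqVneq y 0; first by rewrite addr0.
have [->|xy0] := eqVneq (x + y) 0; first by rewrite /val_prime eqxx leey.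
by rewrite !vE // !lee_fin => nx ny; apply: vD.
Qed.

Lemma nzprime_val_geM P x y (m n : int) : nzprime P ->
  (m%:E <= val_prime P x -> n%:E <= val_prime P y ->
    (m + n)%:E <= val_prime P (x * y))%E.
Proof.
move=> pP; have [v [vE vM _ _ _]] := nzprime_valuation pP.
have [->|x0] := eqVneq x 0; first by rewrite mul0r /val_prime eqxx !leey.
have [->|y0] := eqVneq y 0; first by rewrite mulr0 /val_prime eqxx !leey.
have xy0 := mulf_neq0 x0 y0.
by rewrite !vE // !lee_fin vM //; apply: lerD.
Qed.

Lemma val_idealE P (I : set K) (z : int) :
  (exists2 x, I x & val_prime P x = z%:E) ->
  (forall x, I x -> (z%:E <= val_prime P x)%E) -> val_ideal P I = z.
Proof.
move=> ex min; apply: xget_unique => // n [[y Iy yE] nmin].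
have [x Ix xE] := ex; apply: le_anti; apply/andP; split.
  by rewrite -lee_fin -xE; apply: nmin.
by rewrite -lee_fin -yE; apply: min.
Qed.

Section Outside.
Variable Sigma : set (set K).
Let PO := primes_outside Sigma.

Lemma primes_outside_nzprime P : PO P -> nzprime P. Proof. by case. Qed.

Lemma val_prime1 P : nzprime P -> val_prime P 1 = 0%:E.
Proof.
move=> pP; have [v [vE _ _ _ [v0 _ _]]] := nzprime_valuation pP.
by rewrite vE ?oner_neq0 // v0 //; [exact: OK1|exact: nzprime1].
Qed.

Lemma val_ideal_OKS P : PO P -> val_ideal P (OKS Sigma) = 0.
Proof.
move=> PP; apply: val_idealE => [|x]; last exact.
by exists 1 => [Q /primes_outside_nzprime pQ|]; rewrite val_prime1 //; case: PP.
Qed.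

(** The ideal is cut out by the inequalities v_P >= e P; what takes an argument is that each bound
    is attained. *)
Lemma ex_ideal_val (e : set K -> nat) :
  finite_set [set P | PO P /\ e P != 0%N] ->
  exists I, nonzero_ideal (OKS Sigma) I /\
    forall P, PO P -> val_ideal P I = (e P)%:Z.
Proof.
move=> fin; set S := fset_set [set P | PO P /\ e P != 0%N].
have SP P : P \in S <-> PO P /\ e P != 0%N by rewrite in_fset_set // inE.
pose I : set K := [set x | forall P, PO P -> ((e P)%:Z%:E <= val_prime P x)%E].
have exI P : PO P -> exists x, [/\ I x, x != 0 & val_prime P x = (e P)%:Z%:E].
  move=> PP; have pP := primes_outside_nzprime PP.
  have [|z [Oz nz zS]] := @nzprime_avoidance P [seq Q <- S | Q != P] pP.
    move=> Q; rewrite mem_filter => /andP[/eqP nQ /SP[PQ _]].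
    by split; [exact: primes_outside_nzprime|move=> /esym].
  have z0 : z != 0 by apply/eqP => E; apply: nz; rewrite E; exact: nzprime0.
  have [v [vE vM _ v_ge0 [v0 _ [t Ot [t0 t1]]]]] := nzprime_valuation pP.
  (* The element z lies in the other primes of [S], so z ^ E has valuation at least E >= e Q there,
     while at P its valuation is 0. *)
  pose E := (\sum_(Q <- S) e Q)%N.
  have x0 : t ^+ e P * z ^+ E != 0 by rewrite mulf_neq0 // expf_neq0.
  have vx : val_prime P (t ^+ e P * z ^+ E) = (e P)%:Z%:E.
    rewrite vE // vM ?expf_neq0 // [v (z ^+ E)]v0 ?addr0; last 2 first.
    - exact: OKX.
    - exact: nzprime_notinX.
    congr (_%:E); elim: (e P) => [|k IH].
      by rewrite v0 //; [exact: OK1|exact: nzprime1].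
    by rewrite exprS vM ?expf_neq0 // IH t1 -[1]/(Posz 1) -PoszD add1n.
  exists (t ^+ e P * z ^+ E); split => // Q PQ.
  have [->|/eqP QP] := pselect (Q = P); first by rewrite vx.
  have pQ := primes_outside_nzprime PQ.
  have [u [uE uM _ u_ge0 [_ u1 _]]] := nzprime_valuation pQ.
  rewrite uE // lee_fin uM ?expf_neq0 //.
  have uz : (u (z ^+ E)) = u z *+ E.
    elim: E {x0 vx} => [|k IH]; last by rewrite exprS uM ?expf_neq0 // IH mulrS.
    by apply: (addrI (u 1)); rewrite addr0 -[in RHS](mulr1 1) uM // oner_neq0.
  have [/eqP e0|e0] := boolP (e Q == 0%N).
    rewrite e0 addr_ge0 ?u_ge0 ?expf_neq0 //; exact: OKX.
  have QS : Q \in S by apply/SP.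
  rewrite -[X in X <= _]add0r lerD //.
    by apply: u_ge0; [exact: OKX|rewrite expf_neq0].
  rewrite uz; apply: (@le_trans _ _ E%:Z).
    by rewrite lez_nat /E (big_rem Q) //= leq_addr.
  rewrite -[X in X <= _]natz lerMn2r u1 ?orbT //; apply: zS.
  by rewrite mem_filter QP.
exists I; split => [|P PP]; last first.
  by apply: val_idealE => [|x]; [have [x [Ix _ xE]] := exI P PP; exists x|apply].
split.
  split.
  - by move=> x Ix P PP; apply: le_trans (Ix P PP); rewrite lee_fin.
  - by move=> P PP; rewrite /val_prime eqxx leey.
  - by move=> x y Ix Iy P PP; apply: nzprime_val_geD; [case: PP|exact: Ix|exact: Iy].
  - move=> a x Oa Ix P PP; rewrite -[(e P)%:Z]add0r.
    by apply: nzprime_val_geM; [case: PP|exact: Oa|exact: Ix].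
(* When no prime lies outside [Sigma], the bounds are vacuous and 1 belongs to [I]. *)
have [[P PP]|no] := pselect (exists P, PO P).
  by have [x [Ix x0 _]] := exI P PP; exists x.
by exists 1; rewrite ?oner_neq0 // => P PP; case: no; exists P.
Qed.

End Outside.
End Primes.

(** * Factorial ideals, increments and the coefficients h *)

Section Increments.
Variables (K : fieldExtType rat) (Sigma : set (set K)) (f : set K -> nat) (R : realType).
Implicit Types (P : set K) (u : set K * nat).
Let PO := primes_outside Sigma.
Hypothesis f_gt0 : forall P, PO P -> (0 < f P)%N.
Hypothesis f_fin : forall n, finite_set [set P | PO P /\ (f P <= n)%N].

Lemma idnorm_gt1 P : nzprime P -> (1 < idnorm P)%N.
Proof.
move=> pP; have [p pp Pp] := ex_prime_nzprime pP.
exact: leq_trans (prime_gt1 pp) (leq_idnorm pP pp Pp).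
Qed.

Definition pair_index u := (f u.1 * idnorm u.1 ^ u.2)%N.

Lemma pair_index_gt0 u : PO u.1 -> (0 < pair_index u)%N.
Proof.
move=> PP; rewrite muln_gt0 f_gt0 //= expn_gt0 ltnW //.
by apply: idnorm_gt1; case: PP.
Qed.

(** Hence a pair of index at most n has f(P) <= n and k < n, so that [small_pairs n] contains it;
    the bound on k comes from k < N(P) ^ k. *)
Lemma leq_pair_index u : PO u.1 -> (f u.1 <= pair_index u)%N /\ (u.2 < pair_index u)%N.
Proof.
move=> PP; have N1 : (1 < idnorm u.1)%N by apply: idnorm_gt1; case: PP.
split; first by rewrite leq_pmulr // expn_gt0 ltnW.
apply: (leq_trans (ltn_expl u.2 N1)); by rewrite leq_pmull // f_gt0.
Qed.

Lemma mem_small_primes n P :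
  P \in fset_set [set P | PO P /\ (f P <= n)%N] <-> PO P /\ (f P <= n)%N.
Proof. by rewrite in_fset_set; [split=> [/set_mem|/mem_set]|exact: f_fin]. Qed.

Definition small_pairs n : seq (set K * nat) :=
  [seq (P, k) | P <- fset_set [set P | PO P /\ (f P <= n)%N], k <- iota 0 n.+1].

Lemma small_pairs_uniq n : uniq (small_pairs n).
Proof.
by apply: allpairs_uniq; [exact: fset_uniq|exact: iota_uniq|move=> [? ?] [? ?] _ _ [-> ->]].
Qed.

Lemma small_pairs_PO n u : u \in small_pairs n -> PO u.1.
Proof.
move=> /allpairsP[[P k] /= [PS _ ->]]; by have [] := (mem_small_primes n P).1 PS.
Qed.

Lemma mem_small_pairs n u : PO u.1 -> (pair_index u <= n)%N -> u \in small_pairs n.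
Proof.
case: u => P k PP /= un; have [fu ku] := leq_pair_index (u := (P, k)) PP.
apply/allpairsP; exists (P, k); split => //.
  by apply/mem_small_primes; split => //; apply: leq_trans fu un.
by rewrite mem_iota add0n /=; apply: leq_trans ku _; apply: leq_trans un _.
Qed.

(** The cutoff m is left free so that n and n - 1 can be expanded over a common range. *)
Lemma fact_valE n m P : PO P -> (n <= m)%N ->
  fact_val f n P = (\sum_(k <- iota 0 m.+1) n %/ pair_index (P, k))%N.
Proof.
move=> PP nm; rewrite /fact_val (fsbigE (iota 0 m.+1)) ?iota_uniq //.
  by apply: eq_bigl => k; rewrite in_setT.
move=> k _; rewrite mem_iota add0n /= -leqNgt => mk; apply: divn_small.
have [_ /= kP] := leq_pair_index (u := (P, k)) PP.
exact: leq_ltn_trans nm (ltn_trans mk kP).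
Qed.

Lemma fact_val_eq0 n P : PO P -> (n < f P)%N -> fact_val f n P = 0%N.
Proof.
move=> PP nf; rewrite (fact_valE PP (leqnn n)) big1 // => k _; apply: divn_small.
have [+ _] := leq_pair_index (u := (P, k)) PP; exact: leq_trans.
Qed.

(** For n >= 1, [get] meets its specification because [ex_ideal_val] provides an ideal: only the
    finitely many primes with f(P) <= n have a nonzero exponent. *)
Lemma val_factorial n P : PO P ->
  val_ideal P (factorial_ideal Sigma f n) = (fact_val f n P)%:Z.
Proof.
move=> PP; case: n => [|n].
  by rewrite fact_val_eq0 ?f_gt0 //; apply: val_ideal_OKS.
have /getPex[_] : exists I : set K, nonzero_ideal (OKS Sigma) I /\
    forall P, PO P -> val_ideal P I = (fact_val f n.+1 P)%:Z.
  apply: ex_ideal_val; apply: sub_finite_set (f_fin n.+1) => Q [PQ Q0]; split => //.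
  by rewrite leqNgt; apply: contra Q0 => /(fact_val_eq0 PQ) ->.
exact.
Qed.

Lemma ln_prod (I : eqType) (r : seq I) (F : I -> R) :
  (forall i, i \in r -> 0 < F i) -> ln (\prod_(i <- r) F i) = \sum_(i <- r) ln (F i).
Proof.
elim: r => [|i r IH] rF; first by rewrite !big_nil ln1.
have rF' j : j \in r -> 0 < F j by move=> jr; apply: rF; rewrite inE jr orbT.
rewrite !big_cons lnM ?IH // posrE ?rF ?mem_head //.
by rewrite big_seq; apply: prodr_gt0.
Qed.

Lemma ln_normS_factorial n m : (n <= m)%N ->
  ln (normS Sigma R (factorial_ideal Sigma f n)) =
  \sum_(u <- small_pairs m) (n %/ pair_index u)%:R * ln ((idnorm u.1)%:R : R).
Proof.
move=> nm; have N0 P : PO P -> 0 < (idnorm P)%:R :> R.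
  by move=> [pP _]; rewrite ltr0n ltnW // idnorm_gt1.
rewrite /normS (fsbigE (fset_set [set P | PO P /\ (f P <= m)%N])) ?fset_uniq //; first last.
- move=> P PP nP.
  rewrite val_factorial // fact_val_eq0 ?expr0z //.
  apply: leq_ltn_trans nm _; rewrite ltnNge; apply/negP => fm; by apply: (negP nP);
    apply/mem_small_primes.
- by move=> P /mem_small_primes[].
have memS P : P \in fset_set [set P | PO P /\ (f P <= m)%N] -> PO P.
  by move=> /mem_small_primes[].
have -> : \prod_(P <- fset_set [set P | PO P /\ (f P <= m)%N] | P \in PO)
      ((idnorm P)%:R : R) ^ val_ideal P (factorial_ideal Sigma f n) =
    \prod_(P <- fset_set [set P | PO P /\ (f P <= m)%N])
      (idnorm P)%:R ^ val_ideal P (factorial_ideal Sigma f n).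
  by rewrite big_seq_cond [RHS]big_seq; apply: eq_bigl => P;
    apply: andb_idr => /memS /mem_set.
rewrite ln_prod; last by move=> P /memS PP; rewrite exprz_gt0 // N0.
rewrite big_allpairs_dep /= big_seq [in RHS]big_seq; apply: eq_bigr => P /memS PP.
rewrite val_factorial // -exprnP lnXn ?N0 // (fact_valE PP nm).
by rewrite -[LHS]mulr_natl natr_sum mulr_suml.
Qed.

Lemma Bincr_sum n : (0 < n)%N -> Bincr Sigma f R n =
  \sum_(u <- small_pairs n | (pair_index u %| n)%N) ln ((idnorm u.1)%:R : R).
Proof.
move=> n0; rewrite /Bincr (ln_normS_factorial (leqnn n)) (ln_normS_factorial (leq_pred n)).
rewrite -sumrB [RHS]big_mkcond /= big_seq [in RHS]big_seq; apply: eq_bigr => u /small_pairs_PO PP.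
rewrite -mulrBl; case: n n0 => // n _; rewrite divnS ?pair_index_gt0 // natrD addrK.
by case: dvdn; rewrite ?mul1r ?mul0r.
Qed.

Lemma hcoef_sum n : hcoef Sigma f R n =
  \sum_(u <- small_pairs n | (pair_index u == n)) ln ((idnorm u.1)%:R : R).
Proof.
rewrite /hcoef -[RHS]big_filter; set r := [seq _ <- _ | _].
have rP u : u \in r -> PO u.1 /\ (f u.1 * idnorm u.1 ^ u.2)%N = n.
  rewrite mem_filter => /andP[/eqP un us]; split => //; exact: small_pairs_PO us.
transitivity (\sum_(u <- r | u \in [set u | PO u.1 /\ (f u.1 * idnorm u.1 ^ u.2)%N = n])
    ln ((idnorm u.1)%:R : R)).
  apply: fsbigE => [||u /= [PP un]].
  - by rewrite filter_uniq // small_pairs_uniq.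
  - by move=> u /rP.
  - by rewrite mem_filter /pair_index un eqxx mem_small_pairs // /pair_index un.
rewrite big_seq_cond [RHS]big_seq; apply: eq_bigl => u; apply: andb_idr => /rP.
exact: mem_set.
Qed.

End Increments.

(** * Unconditional sums and their regrouping *)

Local Open Scope complex_scope.

Lemma sum_support (V : zmodType) (T : eqType) (r J : seq T) (F : T -> V) : uniq r -> uniq J ->
  {subset r <= J} -> (forall t, t \notin r -> F t = 0) ->
  \sum_(t <- J) F t = \sum_(t <- r) F t.
Proof.
move=> ur uJ rJ F0; rewrite (bigID (mem r)) /= [X in _ + X]big1 // addr0 -big_filter.
apply: perm_big; apply: uniq_perm; rewrite ?filter_uniq // => t.
by rewrite mem_filter; apply: andb_idr => /rJ.
Qed.

Lemma ler_sum_subset (N : numDomainType) (T : eqType) (r J : seq T) (a : T -> N) :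
    uniq r -> uniq J ->
  {subset r <= J} -> (forall t, 0 <= a t) ->
  \sum_(t <- r) a t <= \sum_(t <- J) a t.
Proof.
move=> ur uJ rJ a0; rewrite [leRHS](bigID (mem r)) /= -[leLHS]addr0.
apply: lerD; last by apply: sumr_ge0.
rewrite -[leRHS]big_filter le_eqVlt; apply/orP; left; apply/eqP.
apply: perm_big; apply: uniq_perm; rewrite ?filter_uniq // => t.
by rewrite mem_filter; apply/esym/andb_idr => /rJ.
Qed.

Lemma sum_fibres (V : zmodType) (T U : eqType) (g : T -> U) (I : seq U) (J : seq T)
    (F : T -> V) : uniq I ->
  \sum_(u <- I) \sum_(t <- J | g t == u) F t = \sum_(t <- J | g t \in I) F t.
Proof.
move=> uI; under eq_bigr do rewrite big_mkcond.
rewrite exchange_big [RHS]big_mkcond; apply: eq_bigr => t _; case: ifPn => gI.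
  rewrite (bigD1_seq (g t)) //= eqxx big1 ?addr0 // => u ugt.
  by rewrite eq_sym (negPf ugt).
by rewrite big1_seq // => u /= uI'; case: eqP gI => // ->; rewrite uI'.
Qed.

Section UnconditionalSums.
Variable R : realType.
Local Notation C := R[i].

(** Convergence along the directed family of finite subsets. In [R[i]] the condition 0 < e forces e
    to be real, so e is an ordinary tolerance. *)
Definition has_sum (T : choiceType) (F : T -> C) (L : C) :=
  forall e : C, 0 < e -> exists J0 : {fset T}, forall J : {fset T},
    (J0 `<=` J)%fset -> `|\sum_(t <- J) F t - L| < e.

Definition abs_bounded (T : choiceType) (F : T -> C) (M : C) :=
  forall J : {fset T}, \sum_(t <- J) `|F t| <= M.

Section OneIndex.
Variable T : choiceType.
Implicit Types (F G : T -> C) (L : C).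

Lemma has_sumD F G L L' : has_sum F L -> has_sum G L' ->
  has_sum (fun t => F t + G t) (L + L').
Proof.
move=> FL GL e e0; have e2 : 0 < e / 2 by rewrite divr_gt0.
have [I IP] := FL _ e2; have [J JP] := GL _ e2.
exists (I `|` J)%fset => A; rewrite fsubUset => /andP[IA JA].
rewrite big_split opprD addrACA (splitr e).
exact: le_lt_trans (ler_normD _ _) (ltrD (IP _ IA) (JP _ JA)).
Qed.

Lemma has_sumZ F L (c : C) : has_sum F L -> has_sum (fun t => c * F t) (c * L).
Proof.
move=> FL e e0; have [->|c0] := eqVneq c 0.
  by exists fset0 => A _; rewrite mul0r big1 ?subrr ?normr0 // => t; rewrite mul0r.
have nc : 0 < `|c| by rewrite normr_gt0.
have [I IP] := FL _ (divr_gt0 e0 nc).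
by exists I => A IA; rewrite -mulr_sumr -mulrBr normrM mulrC -ltr_pdivlMr // IP.
Qed.

Lemma has_sum_finite F (r : seq T) : uniq r -> (forall t, t \notin r -> F t = 0) ->
  has_sum F (\sum_(t <- r) F t).
Proof.
move=> ur F0 e e0; exists [fset t in r]%fset => J /fsubsetP rJ.
rewrite (@sum_support _ _ r) ?fset_uniq ?subrr ?normr0 // => t tr.
by apply: rJ; rewrite !inE.
Qed.

Lemma has_sum_nneg (a : T -> R) (M : R) : (forall t, 0 <= a t) ->
  (forall J : {fset T}, \sum_(t <- J) a t <= M) ->
  exists L : R, has_sum (fun t => (a t)%:C) L%:C.
Proof.
move=> a0 aM; pose S : set R := [set x | exists J : {fset T}, x = \sum_(t <- J) a t].
have hS : has_sup S.
  split; first by exists (\sum_(t <- fset0) a t), fset0.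
  by exists M => _ [J ->]; apply: aM.
exists (sup S) => e e0.
have [re e_re] : exists r : R, e = r%:C.
  by exists (complex.Re e); rewrite RRe_real // gtr0_real.
have re0 : 0 < re by move: e0; rewrite e_re ltcR.
have [_ [J0 ->] lt] := sup_adherent re0 hS.
exists J0 => J J0J; rewrite -rmorph_sum -rmorphB /= e_re normc_def /=.
rewrite expr0n addr0 sqrtr_sqr ltcR distrC ger0_norm; last first.
  by rewrite subr_ge0; apply: (ub_le_sup (proj2 hS)); exists J.
rewrite ltrBlDr addrC -ltrBlDr; apply: (lt_le_trans lt).
by apply: ler_sum_subset; rewrite ?fset_uniq //; apply/fsubsetP.
Qed.

Lemma abs_bounded_has_sum F M : abs_bounded F M -> exists L, has_sum F L.
Proof.
move=> FM.
have part (h : C -> R) : (forall z, `|h z|%:C <= `|z|) ->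
    exists L, has_sum (fun t => (h (F t))%:C) L.
  move=> hz.
  have bd (J : {fset T}) : \sum_(t <- J) `|h (F t)| <= complex.Re M.
    rewrite -lecR rmorph_sum RRe_real /=; last first.
      by apply/ger0_real/(le_trans _ (FM fset0)); rewrite big_seq_fset0.
    by apply: le_trans (FM J); apply: ler_sum => t _; apply: hz.
  have [|J|L1 H1] := @has_sum_nneg (fun t => `|h (F t)|) (complex.Re M); [by []|exact: bd|].
  (* A real part or imaginary part h is the difference of the nonnegative summable families |h| + h
     and |h|. *)
  have [t|J|L2 H2] := @has_sum_nneg (fun t => `|h (F t)| + h (F t)) (complex.Re M + complex.Re M).
  - by rewrite -lerBlDr sub0r -normrN ler_norm.
  - rewrite big_split lerD // (le_trans _ (bd J)) //.
    by apply: ler_sum => t _; apply: ler_norm.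
  exists (L2%:C + -1 * L1%:C).
  have -> : (fun t => (h (F t))%:C) = fun t => (`|h (F t)| + h (F t))%:C + -1 * (`|h (F t)|)%:C.
    by apply/funext => t; rewrite rmorphD /= mulN1r addrAC subrr add0r.
  exact/has_sumD/has_sumZ.
have [L1 H1] := part (@complex.Re R) (@normc_ge_Re R).
have ge_Im (z : C) : `|complex.Im z|%:C <= `|z|.
  by rewrite normc_def lecR -sqrtr_sqr ler_wsqrtr // lerDr sqr_ge0.
have [L2 H2] := part (@complex.Im R) ge_Im.
exists (L1 + 'i * L2).
have -> : F = fun t => (complex.Re (F t))%:C + 'i * (complex.Im (F t))%:C.
  by apply/funext => t; rewrite {1}[F t]complexE.
exact: (has_sumD H1 (has_sumZ _ H2)).
Qed.

End OneIndex.

Lemma abs_bounded_sub (T : choiceType) (F G : T -> C) M :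
  (forall t, `|G t| <= `|F t|) -> abs_bounded F M -> abs_bounded G M.
Proof. by move=> GF FM J; apply: le_trans (FM J); apply: ler_sum. Qed.

Lemma abs_bounded_uniq (T : choiceType) (F : T -> C) M (r : seq T) :
  abs_bounded F M -> uniq r -> \sum_(t <- r) `|F t| <= M.
Proof.
move=> FM ur; apply: le_trans (FM [fset t in r]%fset).
by apply: ler_sum_subset; rewrite ?fset_uniq // => t tr; rewrite !inE.
Qed.

(** A finite set of pairs lies in the rectangle of its projections, over which the sum factors. *)
Lemma abs_bounded_mul (T U : choiceType) (F : T -> C) (G : U -> C) M M' :
  abs_bounded F M -> abs_bounded G M' ->
  abs_bounded (fun u : T * U => F u.1 * G u.2) (M * M').
Proof.
move=> FM GM J.
pose r1 := undup [seq u.1 | u <- J]; pose r2 := undup [seq u.2 | u <- J].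
apply: (@le_trans _ _ (\sum_(u <- [seq (a, b) | a <- r1, b <- r2]) `|F u.1 * G u.2|)).
  apply: ler_sum_subset => //.
  - by apply: allpairs_uniq; rewrite ?undup_uniq // => -[? ?] [? ?] _ _ [-> ->].
  - move=> [a b] uJ; apply/allpairsP; exists (a, b).
    by split => //; rewrite mem_undup; apply/mapP; exists (a, b).
rewrite big_allpairs_dep /=.
under eq_bigr do (under eq_bigr do rewrite normrM; rewrite -mulr_sumr).
rewrite -mulr_suml; apply: ler_pM; rewrite ?sumr_ge0 //.
  by apply: abs_bounded_uniq => //; apply: undup_uniq.
by apply: abs_bounded_uniq => //; apply: undup_uniq.
Qed.

Section Regroup.
Variables (T U : choiceType) (g : T -> U) (F : T -> C) (G : U -> C).
Hypothesis FG : forall u, has_sum (fun t => if g t == u then F t else 0) (G u).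

Lemma fibre_approx (I : {fset U}) (e : C) : 0 < e ->
  exists J0 : {fset T}, forall J : {fset T}, (J0 `<=` J)%fset ->
    \sum_(u <- I) `|\sum_(t <- J | g t == u) F t - G u| <= e.
Proof.
(* The successor keeps k nonzero when [I] is empty. *)
move=> e0; pose k : C := (size I).+1%:R.
have k0 : 0 < k by rewrite ltr0n.
have /choice[J0 JP] : forall u, exists J0 : {fset T}, forall J : {fset T}, (J0 `<=` J)%fset ->
    `|\sum_(t <- J) (if g t == u then F t else 0) - G u| < e / k.
  by move=> u; apply: FG; rewrite divr_gt0.
exists (\bigcup_(u <- I) J0 u)%fset => J sub.
apply: (@le_trans _ _ (\sum_(u <- I) e / k)).
  rewrite big_seq [leRHS]big_seq; apply: ler_sum => u uI; rewrite big_mkcond.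
  apply/ltW/JP; apply: fsubset_trans sub; exact: bigfcup_sup.
rewrite big_const_seq count_predT iter_addr_0 -mulr_natr -mulrA ler_piMr //; first exact: ltW.
by rewrite mulrC ler_pdivrMr // mul1r ler_nat.
Qed.

Lemma has_sum_regroup L : has_sum F L -> has_sum G L.
Proof.
move=> FL e e0; have e2 : 0 < e / 2 by rewrite divr_gt0.
have [J0 JP] := FL _ e2.
exists (g @` J0)%fset => I /fsubsetP sub.
have [J1 JP1] := fibre_approx I e2.
(* Restricting to the preimage of [I] lets the sum over [J] split into fibres over [I]; [J0]
   survives because [I] contains its image. *)
pose J := [fset t in (J0 `|` J1)%fset | g t \in I]%fset.
have J0J : (J0 `<=` J)%fset.
  by apply/fsubsetP => t tJ; rewrite !inE tJ /= sub // in_imfset.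
have E : \sum_(t <- J) F t = \sum_(u <- I) \sum_(t <- (J0 `|` J1)%fset | g t == u) F t.
  rewrite sum_fibres ?fset_uniq // -[RHS]big_filter; apply: perm_big; apply: uniq_perm.
  - exact: fset_uniq.
  - by rewrite filter_uniq // fset_uniq.
  - by move=> t; rewrite mem_filter !inE /= andbC.
have -> : \sum_(u <- I) G u - L =
  (\sum_(t <- J) F t - L) - \sum_(u <- I) (\sum_(t <- (J0 `|` J1)%fset | g t == u) F t - G u).
  by rewrite sumrB -E; ring.
rewrite (splitr e); apply: le_lt_trans (ler_normB _ _) _; apply: ltr_leD; first exact: JP.
apply: le_trans (ler_norm_sum _ _ _) _; apply: JP1.
exact: fsubsetUr.
Qed.

(** One finite [J] approximates the fibre sums over [I] with total error e, and on [J] the triangle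
    inequality gives the bound M; e is arbitrary. *)
Lemma abs_bounded_regroup M : abs_bounded F M -> abs_bounded G M.
Proof.
move=> FM I; apply/ler_addgt0Pl => e e0.
have [J JP] := fibre_approx I e0; have {}JP := JP _ (fsubset_refl J).
have J0J : \sum_(u <- I) `|\sum_(t <- J | g t == u) F t| <= M.
  apply: le_trans (FM J).
  apply: (@le_trans _ _ (\sum_(u <- I) \sum_(t <- J | g t == u) `|F t|)).
    by apply: ler_sum => u _; apply: ler_norm_sum.
  rewrite sum_fibres ?fset_uniq // [leRHS](bigID (fun t => g t \in I)) /= lerDl.
  by rewrite sumr_ge0.
apply: le_trans (lerD JP J0J); rewrite -big_split /=; apply: ler_sum => u _.
rewrite -{1}(subKr (\sum_(t <- J | g t == u) F t) (G u)).
by rewrite addrC (le_trans (ler_normB _ _)).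
Qed.

End Regroup.

Lemma has_sum_unique (T : choiceType) (F : T -> C) L L' :
  has_sum F L -> has_sum F L' -> L = L'.
Proof.
move=> FL FL'; apply/eqP; rewrite -subr_eq0 -normr_eq0; apply: contrapT => /negP ne.
have e0 : 0 < `|L - L'| / 2 by rewrite divr_gt0 // lt_def ne normr_ge0.
have [I IP] := FL _ e0; have [J JP] := FL' _ e0.
have := ltrD (IP _ (fsubsetUl I J)) (JP _ (fsubsetUr I J)).
rewrite -splitr; apply/negP; rewrite -real_leNgt ?realE ?addr_ge0 ?normr_ge0 //.
set S := \sum_(t <- _) _; rewrite (_ : L - L' = (S - L') - (S - L)); last by ring.
by rewrite [leRHS]addrC; apply: ler_normB.
Qed.

(** Inside the product, the row of a inherits the absolute bound; grouping it along [snd] leaves one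
    possibly nonzero term in each fibre. *)
Lemma has_sum_row (T U : choiceType) (F : T * U -> C) M (a : T) : abs_bounded F M ->
  exists2 L, has_sum (fun t => if t.1 == a then F t else 0) L & has_sum (fun b => F (a, b)) L.
Proof.
move=> FM; have [|L FL] := @abs_bounded_has_sum _ (fun t => if t.1 == a then F t else 0) M.
  by apply: abs_bounded_sub FM => t; case: ifP; rewrite ?normr0.
exists L => //; apply: (has_sum_regroup (g := snd) _ FL) => b.
have := @has_sum_finite _ (fun t : T * U => if t.2 == b then if t.1 == a then F t else 0 else 0)
  [:: (a, b)] isT.
rewrite big_seq1 /= !eqxx; apply => -[x y] /=.
by rewrite inE xpair_eqE; case: (y =P b) => //; case: (x =P a).
Qed.

(* The sums of [G] and of its shift [0, x * G 0, x * G 1, ...] differ by [A]. *)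
Lemma has_sum_geometric (A x L : C) (G : nat -> C) : G 0%N = A ->
  (forall k, G k.+1 = x * G k) -> has_sum G L -> L * (1 - x) = A.
Proof.
move=> G0 GS GL.
have shift : has_sum (fun k => if k is k'.+1 then x * G k' else 0) (x * L).
  apply: (has_sum_regroup (g := succn) _ (has_sumZ x GL)) => -[|k].
    by rewrite -[X in has_sum _ X](big_nil 0 +%R xpredT (fun _ : nat => 0 : C));
      apply: has_sum_finite.
  have := @has_sum_finite _ (fun t => if t.+1 == k.+1 then x * G t else 0) [:: k] isT.
  rewrite big_seq1 eqxx; apply => t; rewrite inE => /negPf tk.
  by rewrite eqSS tk.
have dif := has_sumD GL (has_sumZ (-1) shift).
have := @has_sum_finite _ (fun k => G k + -1 * (if k is k'.+1 then x * G k' else 0)) [:: 0%N] isT.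
rewrite big_seq1 mulr0 addr0 G0 => fin.
rewrite mulrBr mulr1 [L * x]mulrC -mulN1r; apply: has_sum_unique dif _; apply: fin => -[//|k] _.
by rewrite GS mulN1r subrr.
Qed.

End UnconditionalSums.

(** * From unconditional sums to the limits and sums of the statement *)

Section Conversions.
Variable R : realType.
Local Notation C := R[i].

Lemma has_sum_series (G : nat -> C) (L : C) : has_sum G L ->
  series (G : nat -> C^o) @ \oo --> (L : C^o).
Proof.
move=> GL; apply/cvgrPdist_lt => e e0; have [J0 JP] := GL _ e0.
exists (\max_(i <- J0) i).+1 => // n /= n0.
rewrite distrC /series /= /index_iota subn0.
rewrite (_ : \sum_(k <- iota 0 n) G k = \sum_(k <- [fset k in iota 0 n]%fset) G k).
  apply: JP; apply/fsubsetP => i iJ; rewrite !inE mem_iota add0n /=.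
  by apply: leq_trans n0; rewrite ltnS; apply: leq_bigmax_seq.
apply: perm_big; apply: uniq_perm; rewrite ?iota_uniq ?fset_uniq // => i.
by rewrite !inE.
Qed.

Lemma has_sum_limn (G : nat -> C) (L : C) : has_sum G L ->
  limn (series (G : nat -> C^o)) = L.
Proof. by move=> /has_sum_series /cvg_lim; apply. Qed.

Lemma abs_bounded_cvg (G : nat -> C) M : abs_bounded G M ->
  cvgn (series (fun n => Normc.normc (G n))).
Proof.
move=> GM; apply: nondecreasing_is_cvgn.
  by apply: nondecreasing_series => n _ _; rewrite -lecR; apply: (normr_ge0 (G n)).
exists (complex.Re M) => _ [n _ <-]; rewrite /series /= -lecR rmorph_sum RRe_real /=.
  by apply: abs_bounded_uniq GM _; rewrite iota_uniq.
by apply/ger0_real/(le_trans _ (GM fset0)); rewrite big_seq_fset0.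
Qed.

Lemma has_sum_sum_over (T : choiceType) (D : set T) (F : T -> C) (L : C) :
  has_sum (fun x => if x \in D then F x else 0) L -> sum_over D F = L.
Proof.
move=> FL; rewrite /sum_over /summability.sum.
have FF := @summability.totally_filter T.
apply: (@cvg_lim C^o); first exact: norm_hausdorff.
apply/cvgrPdist_lt => e e0; have [J0 JP] := FL _ e0.
exists J0 => // J /= J0J.
by rewrite distrC /summability.partial_sum -(big_seq_fsetE _ _ xpredT
  (fun x => if x \in D then F x else 0)); apply: JP.
Qed.

Lemma abs_bounded_summable (T : choiceType) (D : set T) (F : T -> C) M :
  abs_bounded (fun x => if x \in D then F x else 0) M -> abs_summable D F.
Proof.
move=> FM; rewrite /abs_summable /summable.
apply: (@le_lt_trans _ _ (complex.Re M)%:E); last exact: ltry.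
apply: ub_ereal_sup => _ [A [finA AD] <-].
rewrite fsbig_finite //.
under eq_bigr do rewrite abse_EFin.
rewrite sumEFin lee_fin -lecR rmorph_sum RRe_real /=; last first.
  by apply/ger0_real/(le_trans _ (FM fset0)); rewrite big_seq_fset0.
apply: le_trans (FM (fset_set A)); rewrite big_seq [leRHS]big_seq.
apply: ler_sum => x; rewrite in_fset_set // => /set_mem /AD Dx.
by rewrite mem_set // ger0_norm // -lecR; apply: (normr_ge0 (F x)).
Qed.

End Conversions.

(** * Real powers and the convergence of the zeta series *)

Section RealBounds.
Variable R : realType.

Lemma ln_le_sub1 (y : R) : 0 < y -> ln y <= y - 1.
Proof. by move=> y0; rewrite lerBrDl -[leRHS]lnK ?posrE // expR_ge1Dx. Qed.

Lemma powR_addr (x r t : R) : 0 < x -> x `^ (r + t) = x `^ r * x `^ t.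
Proof. by move=> x0; rewrite powRD // (gt_eqF x0) implybT. Qed.

(** A telescoping form of the integral test for the exponent a + 1. It follows from 1 + y <= exp y
    for y = a (ln (x + 1) - ln x) and from ln (x + 1) - ln x >= 1 / (x + 1). *)
Lemma powR_telescope (a x : R) : 0 < a -> 0 < x ->
  a * (x + 1) `^ (- (a + 1)) <= x `^ (- a) - (x + 1) `^ (- a).
Proof.
move=> a0 x0; have x1 : 0 < x + 1 by rewrite addr_gt0.
have -> : (x + 1) `^ (- (a + 1)) = (x + 1) `^ (- a) / (x + 1).
  by rewrite opprD powR_addr // powR_inv1 // ltW.
have -> : x `^ (- a) = (x + 1) `^ (- a) * expR (a * (ln (x + 1) - ln x)).
  rewrite /powR !gt_eqF // -expRD; congr expR; ring.
rewrite mulrCA -[X in _ - X]mulr1 -mulrBr ler_wpM2l ?powR_ge0 //.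
rewrite lerBrDl; apply: le_trans (expR_ge1Dx _).
rewrite lerD2l; apply: ler_wpM2l; first exact: ltW.
have := @ln_le_sub1 (x / (x + 1)) (divr_gt0 x0 x1).
rewrite lnM ?posrE ?invr_gt0 // lnV ?posrE //.
have -> : x / (x + 1) - 1 = - (x + 1)^-1 by field; rewrite gt_eqF.
by lra.
Qed.

Lemma riemann_bound (tau : R) : 1 < tau -> exists Z : R, forall s : seq nat, uniq s ->
  \sum_(n <- s) n.+1%:R `^ (- tau) <= Z.
Proof.
move=> tau1; pose a := tau - 1; have a0 : 0 < a by rewrite subr_gt0.
have tel n : a * \sum_(k < n) k.+2%:R `^ (- tau) <= 1 - n.+1%:R `^ (- a) :> R.
  elim: n => [|n IH]; first by rewrite big_ord0 mulr0 powR1 subrr.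
  rewrite big_ord_recr mulrDr /=.
  have := @powR_telescope a n.+1%:R a0 (ltr0Sn _ _).
  rewrite natr1 (_ : - (a + 1) = - tau); last by rewrite /a; ring.
  by move: IH; set u := a * \sum_(_ < _) _; set v := a * _; lra.
(* The first term contributes 1 and the telescoped rest at most 1 / a. *)
exists (1 + a^-1) => s us.
pose m := (\max_(n <- s) n).+1.
apply: (@le_trans _ _ (\sum_(n <- iota 0 m.+1) n.+1%:R `^ (- tau))).
  apply: ler_sum_subset; rewrite ?iota_uniq // => n ns.
  by rewrite mem_iota add0n /= ltnS leqW //; apply: leq_bigmax_seq.
rewrite -[iota 0 m.+1]/(index_iota 0 m.+1) big_mkord big_ord_recl powR1 lerD2l.
rewrite -[leRHS]mul1r ler_pdivlMr // mulrC.
by apply: le_trans (tel m) _; rewrite lerBlDr lerDl powR_ge0.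
Qed.

End RealBounds.

(** * Growth of f and convergence of the sum over primes *)

Section PrimeBounds.
Variables (K : fieldExtType rat) (Sigma : set (set K)) (f : set K -> nat) (R : realType).
Implicit Types (P : set K).
Let PO := primes_outside Sigma.
Hypothesis f_adm : admissible Sigma f R.

(** If f(P) < c N(P) / 2, the error term exceeds c N(P) / 2, which bounds N(P) by a constant X; then
    f(P) >= 1 >= N(P) / X. *)
Lemma admissible_lower : exists2 c : R, 0 < c &
  forall P, PO P -> c * (idnorm P)%:R <= (f P)%:R.
Proof.
have [f0 [c [d [M [c0 d0 fP]]]]] := f_adm.
(* From c n / 2 <= |M| n ^ (1 - d) follows n ^ d <= 2 |M| / c; the added 1 makes the base
   positive. *)
pose X : R := (`|M| * 2 / c + 1) `^ d^-1.
have X0 : 0 < X.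
  apply: powR_gt0; apply: ltr_wpDl => //; apply: divr_ge0; last exact: ltW.
  exact: mulr_ge0.
exists (Num.min (c / 2) X^-1); first by rewrite lt_min; apply/andP; split;
  [exact: divr_gt0|rewrite invr_gt0].
move=> P PP; set n : R := (idnorm P)%:R.
have n0 : 0 < n by rewrite ltr0n ltnW // idnorm_gt1 //; case: PP.
have [|lt] := lerP (c / 2 * n) (f P)%:R.
  by apply: le_trans; apply: ler_wpM2r; [exact: ltW|rewrite ge_min lexx].
suff nX : n <= X.
  apply: (@le_trans _ _ (X^-1 * n)); first by apply: ler_wpM2r;
    [exact: ltW|rewrite ge_min lexx orbT].
  by rewrite mulrC ler_pdivrMr // (le_trans nX) //; apply: ler_peMl; [exact: ltW|rewrite ler1n f0].
have h : c / 2 * n <= `|M| * n `^ (1 - d).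
  apply: le_trans (le_trans (fP P PP) _); last by apply: ler_wpM2r;
    [exact: powR_ge0|exact: ler_norm].
  by rewrite distrC; apply: le_trans (ler_norm _); move: lt; rewrite -/n; lra.
have nd : n `^ d <= `|M| * 2 / c + 1.
  have p0 := powR_gt0 (1 - d) n0.
  have nE : n = n `^ (1 - d) * n `^ d.
    by rewrite -powR_addr // subrK powRr1 // ltW.
  rewrite {1}nE mulrCA [leRHS]mulrC ler_pM2l // in h.
  apply: (@le_trans _ _ (`|M| * 2 / c)); last by rewrite lerDl.
  by rewrite ler_pdivlMr // -ler_pdivrMr //; move: h; lra.
rewrite (_ : n = (n `^ d) `^ d^-1); last by rewrite -powRrM divff ?gt_eqF // powRr1 // ltW.
by apply: ge0_ler_powR; rewrite ?nnegrE ?invr_ge0 ?powR_ge0 ?(le_trans (powR_ge0 _ _) nd) // ltW.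
Qed.

Lemma finite_nzprime_over p : prime p -> finite_set [set P | @nzprime K P /\ P p%:R].
Proof.
move=> pp; apply: contrapT => /(infinite_set_fset (\dim {:K}).+1)[B BP szB].
have := @leq_size_nzprime_over K p B pp (fset_uniq B) (fun P PB => BP P PB).
by rewrite leqNgt szB.
Qed.

Lemma admissible_finite n : finite_set [set P | PO P /\ (f P <= n)%N].
Proof.
have [c c0 cP] := admissible_lower.
pose m := (Num.truncn (n%:R / c : R)).+1.
apply: (@sub_finite_set _ _ (\bigcup_(p in `I_m) [set P | prime p /\ (@nzprime K P /\ P p%:R)])).
  move=> P [PP fn]; have pP : nzprime P by case: PP.
  have [p pp Pp] := ex_prime_nzprime pP; exists p => //=.
  rewrite /m ltnS; apply: leq_trans (leq_idnorm pP pp Pp) _.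
  have x0 : 0 <= n%:R / c by apply: divr_ge0; [|exact: ltW].
  rewrite truncn_ge_nat // ler_pdivlMr // mulrC.
  by apply: le_trans (cP P PP) _; rewrite ler_nat.
apply: bigcup_finite; first exact: finite_II.
move=> p _; have [pp|np] := boolP (prime p).
  by apply: sub_finite_set (finite_nzprime_over pp) => P [_].
by apply: sub_finite_set (@finite_set0 _) => P [].
Qed.

(** Half of sigma - 1 absorbs the logarithm: ln N <= N ^ e / e leaves N ^ (- tau) with tau > 1,
    which is at most p ^ (- tau) for the rational prime p in P. Each p occurs for at most [K : Q]
    primes P. *)
Lemma prime_sum_bound (sigma : R) : 1 < sigma -> exists M : R, forall s : seq (set K),
  uniq s -> (forall P, P \in s -> PO P) ->
  \sum_(P <- s) ln (idnorm P)%:R * (f P)%:R `^ (- sigma) <= M.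
Proof.
move=> s1; have [c c0 cP] := admissible_lower.
pose e := (sigma - 1) / 2; have e0 : 0 < e by rewrite divr_gt0 // subr_gt0.
pose tau := sigma - e; have tau1 : 1 < tau by rewrite /tau /e; lra.
have [Z ZP] := riemann_bound tau1.
have /choice[q qP] : forall P, exists p, PO P -> prime p /\ P p%:R.
  move=> P; have [[pP _]|nP] := pselect (PO P); last by exists 0%N.
  by have [p pp Pp] := ex_prime_nzprime pP; exists p.
pose A := e^-1 * c `^ (- sigma).
have A0 : 0 <= A by rewrite mulr_ge0 ?powR_ge0 // invr_ge0 ltW.
exists (A * ((\dim {:K})%:R * Z)) => s us sP.
have term P : P \in s -> ln (idnorm P)%:R * (f P)%:R `^ (- sigma) <= A * (q P)%:R `^ (- tau).
  move=> /sP PP; have [pp Pp] := qP P PP; have pP : nzprime P by case: PP.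
  have n0 : 0 < (idnorm P)%:R :> R by rewrite ltr0n ltnW // idnorm_gt1.
  have q0 : 0 < (q P)%:R :> R by rewrite ltr0n prime_gt0.
  have powR_anti (x y z : R) : 0 < x -> x <= y -> 0 <= z -> y `^ (- z) <= x `^ (- z).
    move=> x0 xy z0; have y0 := lt_le_trans x0 xy.
    rewrite !powRN lef_pV2 ?posrE ?powR_gt0 //.
    by apply: ge0_ler_powR => //; rewrite nnegrE ltW.
  have lnle : ln (idnorm P)%:R <= e^-1 * (idnorm P)%:R `^ e.
    rewrite mulrC ler_pdivlMr // mulrC -ln_powR.
    apply: le_trans (ln_le_sub1 _) _; first exact: powR_gt0.
    by rewrite gerBl.
  apply: (@le_trans _ _ (e^-1 * (idnorm P)%:R `^ e * (c `^ (- sigma) * (idnorm P)%:R `^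
    (- sigma)))).
    apply: ler_pM => //; rewrite ?powR_ge0 //.
      by rewrite ln_ge0 // ler1n ltnW // idnorm_gt1.
    rewrite -powRM; [|exact: ltW|exact: ltW].
    by apply: powR_anti; [exact: mulr_gt0|exact: cP|exact: ltW (lt_trans ltr01 s1)].
  rewrite mulrACA -/A; apply: ler_wpM2l => //; rewrite -powR_addr //.
  rewrite (_ : e - sigma = - tau); last by rewrite /tau; ring.
  apply: powR_anti => //; last exact: ltW (lt_trans ltr01 tau1).
  by rewrite ler_nat; apply: leq_idnorm.
rewrite big_seq; apply: le_trans (ler_sum _ term) _.
rewrite -big_seq -mulr_sumr ler_wpM2l //.
(* Rational primes are listed by their predecessors because [riemann_bound] sums over [n.+1]. *)
pose r := undup [seq (q P).-1 | P <- s].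
have -> : \sum_(P <- s) (q P)%:R `^ (- tau) =
   \sum_(n <- r) \sum_(P <- s | (q P).-1 == n) (q P)%:R `^ (- tau) :> R.
  rewrite sum_fibres ?undup_uniq // [LHS]big_seq [RHS]big_seq_cond.
  by apply: eq_bigl => P; apply/esym/andb_idr => Ps; rewrite mem_undup; apply/mapP; exists P.
apply: (@le_trans _ _ (\sum_(n <- r) (\dim {:K})%:R * n.+1%:R `^ (- tau))).
  apply: ler_sum => n _; rewrite -big_filter.
  have qn P : P \in [seq P <- s | (q P).-1 == n] -> PO P /\ q P = n.+1.
    rewrite mem_filter => /andP[/eqP <- /sP PP]; split => //.
    by rewrite prednK // prime_gt0 //; case: (qP P PP).
  rewrite big_seq (eq_bigr (fun=> n.+1%:R `^ (- tau))); last by move=> P /qn[_ ->].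
  rewrite -big_seq big_const_seq count_predT iter_addr_0 -[leLHS]mulr_natl.
  apply: ler_wpM2r; first exact: powR_ge0.
  rewrite ler_nat; case: [seq _ <- _ | _] qn (filter_uniq (fun P => (q P).-1 == n) us) => //
    P0 t qn ut.
  have [PO0 q0] := qn P0 (mem_head _ _); have [pp _] := qP _ PO0.
  apply: (leq_size_nzprime_over (p := n.+1) _ ut); first by rewrite -q0.
  move=> P /qn[PP <-]; split; first by case: PP.
  by case: (qP P PP).
by rewrite -mulr_sumr; apply: ler_wpM2l => //; apply/ZP/undup_uniq.
Qed.

End PrimeBounds.

(** * Complex powers of natural numbers *)

Section NatPow.
Variable R : realType.
Implicit Types (s z w : R[i]).

Lemma cexpD z w : cexp (z + w) = cexp z * cexp w.
Proof.
case: z w => [a b] [c d]; rewrite /cexp /= expRD sinD cosD rmorphM mulrACA; congr (_ * _).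
transitivity ((cos b * cos d - sin b * sin d) +i* (cos b * sin d + sin b * cos d)); last by [].
by congr (_ +i* _); ring.
Qed.

Lemma cexp0 : cexp (0 : R[i]) = 1.
Proof. by rewrite /cexp /= expR0 cos0 sin0 mul1r. Qed.

Lemma norm_cexp z : `|cexp z| = (expR (complex.Re z))%:C.
Proof.
rewrite /cexp normrM !normc_def /= cos2Dsin2 sqrtr1 mulr1 expr0n addr0 sqrtr_sqr.
by rewrite ger0_norm // expR_ge0.
Qed.

Lemma norm_natpow n s : (0 < n)%N -> `|natpow n s| = (n%:R `^ complex.Re s)%:C.
Proof.
move=> n0; rewrite /natpow norm_cexp /powR gt_eqF ?ltr0n //; congr ((expR _)%:C).
by case: s => a b /=; ring.
Qed.

Lemma natpowM m n s : (0 < m)%N -> (0 < n)%N -> natpow (m * n) s = natpow m s * natpow n s.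
Proof.
move=> m0 n0; rewrite /natpow natrM lnM ?posrE ?ltr0n // rmorphD mulrDr.
exact: cexpD.
Qed.

Lemma natpow_neq0 n s : natpow n s != 0.
Proof. by rewrite -normr_eq0 norm_cexp gt_eqF // ltcR expR_gt0. Qed.

Lemma natpowN n s : natpow n (- s) = (natpow n s)^-1.
Proof.
apply: (mulfI (natpow_neq0 n s)); rewrite mulfV ?natpow_neq0 // /natpow mulNr -cexpD.
by rewrite subrr cexp0.
Qed.

End NatPow.

(** * The families over pairs (P, k) and triples (q, P, k) *)

Section PairSums.
Variables (R : realType) (K : fieldExtType rat) (Sigma : set (set K)) (f : set K -> nat).
Hypothesis f_adm : admissible Sigma f R.
Variable s : R[i].
Hypothesis hs : 1 < complex.Re s.
Let PO := primes_outside Sigma.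
Let f_gt0 : forall P, PO P -> (0 < f P)%N := proj1 f_adm.
Let f_fin := admissible_finite f_adm.

Let pair_gt0 u : PO u.1 -> (0 < pair_index f u)%N := pair_index_gt0 f_gt0 (u := u).

Definition pair_term (u : set K * nat) : R[i] :=
  if u.1 \in PO then (ln ((idnorm u.1)%:R : R))%:C / natpow (pair_index f u) s else 0.

(** As N(P) >= 2 and Re s > 1, the modulus of a term is at most log N(P) f(P) ^ (- Re s) times 2 ^
    (- k), the product of a summable family in P and one in k. *)
Lemma abs_bounded_pair_term : exists M, abs_bounded pair_term M.
Proof.
have [M MP] := prime_sum_bound f_adm hs.
pose a P : R := if P \in PO then ln (idnorm P)%:R * (f P)%:R `^ (- complex.Re s) else 0.
have ln_idnorm_ge0 P : PO P -> 0 <= ln ((idnorm P)%:R : R).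
  by move=> [pP _]; rewrite ln_ge0 // ler1n ltnW // idnorm_gt1.
have a0 P : 0 <= a P.
  rewrite /a; case: ifP => // /set_mem PP; apply: mulr_ge0; last exact: powR_ge0.
  exact: ln_idnorm_ge0.
have aM : abs_bounded (fun P => (a P)%:C) M%:C.
  move=> J; rewrite (eq_bigr (fun P => (a P)%:C)); last first.
    by move=> P _; rewrite ger0_norm // lecR.
  rewrite -rmorph_sum /= lecR /a -big_mkcond /= -big_filter.
  apply: MP; first by rewrite filter_uniq // fset_uniq.
  by move=> P; rewrite mem_filter => /andP[/set_mem].
have bM : abs_bounded (fun k => ((2^-1 : R) ^+ k)%:C) 2%:C.
  move=> J; rewrite (eq_bigr (fun k => ((2^-1 : R) ^+ k)%:C)); last first.
    by move=> k _; rewrite ger0_norm // lecR exprn_ge0 // invr_ge0.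
  rewrite -rmorph_sum /= lecR.
  pose m := (\max_(n <- J) n).+1.
  apply: (@le_trans _ _ (\sum_(k <- iota 0 m) (2^-1 : R) ^+ k)).
    apply: ler_sum_subset; rewrite ?iota_uniq ?fset_uniq // => k kJ.
    by rewrite mem_iota add0n /= ltnS; apply: leq_bigmax_seq.
  rewrite -[iota 0 m]/(index_iota 0 m) big_mkord.
  have E : \sum_(k < m) (2^-1 : R) ^+ k = 2 * (1 - 2^-1 ^+ m).
    elim: (m) => [|j IH]; first by rewrite big_ord0 expr0 subrr mulr0.
    by rewrite big_ord_recr /= IH exprS; field.
  rewrite E ler_piMr // lerBlDr lerDl exprn_ge0 // invr_ge0.
exists (M%:C * 2%:C); apply: abs_bounded_sub (abs_bounded_mul aM bM) => -[P k].
rewrite /pair_term /a /=; case: ifP => [/set_mem PP|_]; last by rewrite normr0 normr_ge0.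
have n0 : (0 < idnorm P)%N by rewrite ltnW // idnorm_gt1 //; case: PP.
have l0 := ln_idnorm_ge0 P PP.
have -> : `|(ln (idnorm P)%:R)%:C / natpow (pair_index f (P, k)) s| =
    (ln (idnorm P)%:R * (pair_index f (P, k))%:R `^ (- complex.Re s))%:C.
  rewrite normrM normfV norm_natpow; last exact: (pair_gt0 (u := (P, k)) PP).
  by rewrite ger0_norm ?lecR // powRN -fmorphV -rmorphM.
rewrite -rmorphM /= ger0_norm; last first.
  rewrite lecR; apply: mulr_ge0; last by rewrite exprn_ge0 // invr_ge0.
  by apply: mulr_ge0 => //; exact: powR_ge0.
rewrite lecR -mulrA; apply: ler_wpM2l => //.
rewrite /pair_index natrM powRM //; apply: ler_wpM2l; first exact: powR_ge0.
rewrite powRN /=.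
have np : 0 < ((idnorm P ^ k)%:R : R) by rewrite ltr0n expn_gt0 n0.
rewrite exprVn lef_pV2 ?posrE ?exprn_gt0 ?powR_gt0 //.
apply: (@le_trans _ _ (idnorm P ^ k)%:R); last first.
  by apply: le1r_powR; [rewrite ler1n expn_gt0 n0|exact: ltW].
rewrite natrX lerXn2r ?nnegrE // ler_nat idnorm_gt1 //; by case: PP.
Qed.

(** The predecessor matches the shift in [dirichlet_term]. It would confuse the indices 0 and 1, but
    an index is positive wherever [pair_term] is not set to 0. *)
Lemma has_sum_hcoef n :
  has_sum (fun u => if (pair_index f u).-1 == n then pair_term u else 0)
    (dirichlet_term (fun m => (hcoef Sigma f R m)%:C) s n).
Proof.
set F := (X in has_sum X _).
have -> : dirichlet_term (fun m => (hcoef Sigma f R m)%:C) s n =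
    \sum_(u <- small_pairs Sigma f n.+1) F u.
  rewrite /dirichlet_term (hcoef_sum R f_gt0 f_fin) big_mkcond rmorph_sum mulr_suml /=.
  rewrite big_seq [RHS]big_seq; apply: eq_bigr => u /(small_pairs_PO f_fin) PP.
  rewrite /F /pair_term mem_set //.
  rewrite -{1}(prednK (pair_gt0 PP)) eqSS; case: eqP => [<-|_]; last by rewrite mul0r.
  by rewrite prednK // pair_gt0.
apply: has_sum_finite; first exact: small_pairs_uniq.
move=> u nu; rewrite /F; case: eqP => // un; rewrite /pair_term.
case: ifP => // /set_mem PP; case/negP: nu.
by apply: (mem_small_pairs f_gt0 f_fin) => //; rewrite -un prednK // pair_gt0.
Qed.

(** For fixed P the terms form a geometric progression in k of ratio x = N(P) ^ (- s), and |x| < 1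
    makes 1 - x invertible. *)
Lemma has_sum_prime P :
  has_sum (fun u => if u.1 == P then pair_term u else 0)
    (if P \in PO then prime_term f s P else 0).
Proof.
have [M FM] := abs_bounded_pair_term.
have [L FL rowL] := has_sum_row P FM.
case: ifPn => [/set_mem PP|nP]; last first.
  suff L0 : L = 0 by move: FL; rewrite L0.
  apply: (has_sum_unique rowL); have := @has_sum_finite _ _ (fun k => pair_term (P, k)) [::] isT.
  by rewrite big_nil; apply => k _; rewrite /pair_term /= (negPf nP).
suff -> : prime_term f s P = L by [].
have n1 : (1 < idnorm P)%N by apply: idnorm_gt1; case: PP.
have n0 := ltnW n1.
pose x := natpow (idnorm P) (- s).
have x1 : 1 - x != 0.
  rewrite subr_eq0; apply/eqP => x1; have := congr1 Num.norm x1.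
  rewrite normr1 norm_natpow // => /esym /(congr1 (@complex.Re R)) /= /eqP; apply/negP.
  rewrite lt_eqF // (_ : complex.Re (- s) = - complex.Re s); last by case: (s).
  rewrite powRN invf_lt1 ?powR_gt0 ?ltr0n //.
  apply: (lt_le_trans (y := (idnorm P)%:R)); first by rewrite ltr1n.
  by apply: le1r_powR; [rewrite ler1n|exact: ltW].
have E : L * (1 - x) = (ln (idnorm P)%:R)%:C / natpow (f P) s.
  apply: (has_sum_geometric _ _ rowL).
    by rewrite /pair_term /= mem_set // /pair_index /= expn0 muln1.
  move=> k; rewrite /pair_term /= mem_set // /pair_index /= expnS mulnCA natpowM //.
    by rewrite /x natpowN invfM mulrCA.
  exact: (pair_gt0 (u := (P, k)) PP).
rewrite /prime_term -/x; apply: (mulIf x1); rewrite E.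
by move: (natpow_neq0 (f P) s) => nf0; field; rewrite nf0.
Qed.

(** General term of the expanded product zeta(s) H(s), with q shifted by one as in
    [dirichlet_term]. *)
Definition product_term (t : nat * (set K * nat)) : R[i] := (natpow t.1.+1 s)^-1 * pair_term t.2.

Lemma has_sum_Bincr n :
  has_sum (fun t => if (t.1.+1 * pair_index f t.2).-1 == n then product_term t else 0)
    (dirichlet_term (fun m => (Bincr Sigma f R m)%:C) s n).
Proof.
set F := (X in has_sum X _).
pose D := [seq u <- small_pairs Sigma f n.+1 | (pair_index f u %| n.+1)%N].
(* A pair whose index divides n + 1 occurs with exactly one q, where q + 1 is the quotient; so [h]
   enumerates the nonzero terms of the fibre over n. *)
pose h u := ((n.+1 %/ pair_index f u).-1, u).
have DP u : u \in D -> [/\ PO u.1, (0 < pair_index f u)%N, (0 < n.+1 %/ pair_index f u)%N &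
    (n.+1 %/ pair_index f u * pair_index f u = n.+1)%N].
  rewrite mem_filter => /andP[dv us]; have PP := small_pairs_PO f_fin us.
  by split => //; [exact: pair_gt0|rewrite divn_gt0 ?pair_gt0 // dvdn_leq|exact: divnK].
have -> : dirichlet_term (fun m => (Bincr Sigma f R m)%:C) s n = \sum_(t <- [seq h u | u <- D]) F t.
  rewrite /dirichlet_term (Bincr_sum R f_gt0 f_fin) //
    -big_filter -/D rmorph_sum mulr_suml /= big_map.
  rewrite big_seq [RHS]big_seq; apply: eq_bigr => u /DP[PP u0 q0 E].
  rewrite /F /h /= prednK // E eqxx /product_term /pair_term /= prednK // mem_set //.
  by rewrite -{1}E natpowM // invfM mulrCA.
apply: has_sum_finite.
  rewrite map_inj_uniq; last by move=> u v [].
  by rewrite filter_uniq // small_pairs_uniq.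
move=> [q u] nu; rewrite /F /=; case: eqP => // un; rewrite /product_term /pair_term /=.
case: ifP => [/set_mem PP|]; last by rewrite mulr0.
have E : (q.+1 * pair_index f u = n.+1)%N by rewrite -un prednK // muln_gt0 pair_gt0.
case/negP: nu; apply/mapP; exists u; last by rewrite /h -E mulnK ?pair_gt0.
rewrite mem_filter -{1}E dvdn_mull //=; apply: (mem_small_pairs f_gt0 f_fin) => //.
by rewrite -E leq_pmull.
Qed.

Lemma abs_bounded_zeta : exists M, abs_bounded (fun q => (natpow q.+1 s)^-1) M.
Proof.
have [Z ZP] := riemann_bound hs; exists Z%:C => J.
rewrite (eq_bigr (fun q => (q.+1%:R `^ (- complex.Re s))%:C)); last first.
  by move=> q _; rewrite normfV norm_natpow // powRN -fmorphV.
by rewrite -rmorph_sum lecR; apply: ZP; rewrite fset_uniq.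
Qed.

End PairSums.

Theorem proposition3p1 (R : realType) (K : fieldExtType rat)
    (Sigma : set (set K)) (f : set K -> nat)
    (Sigma_fin : finite_set Sigma) (Sigma_prime : Sigma `<=` @nzprime K)
    (f_adm : admissible Sigma f R) (s : R[i]) (hs : 1 < complex.Re s) :
  [/\ dirichlet_abs_cvg (fun m => (hcoef Sigma f R m)%:C) s,
      abs_summable (primes_outside Sigma) (prime_term f s),
      Hseries Sigma f s
        = sum_over (primes_outside Sigma) (prime_term f s),
      dirichlet_abs_cvg (fun n => (Bincr Sigma f R n)%:C) s
    & Dseries Sigma f s = zeta s * Hseries Sigma f s].
Proof.
have [M FM] := abs_bounded_pair_term f_adm hs.
have [Z ZM] := abs_bounded_zeta hs.
have [H FH] := abs_bounded_has_sum FM.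
have [z Zz] := abs_bounded_has_sum ZM.
have F2M := abs_bounded_mul ZM FM.
have [D FD] := abs_bounded_has_sum F2M.
have hH := has_sum_hcoef f_adm s; have hP := has_sum_prime f_adm hs.
have hB := has_sum_Bincr f_adm s.
have HE : Hseries Sigma f s = H := has_sum_limn (has_sum_regroup hH FH).
split.
- exact: abs_bounded_cvg (abs_bounded_regroup hH FM).
- exact: abs_bounded_summable (abs_bounded_regroup hP FM).
- by rewrite HE; apply/esym/has_sum_sum_over/(has_sum_regroup hP FH).
- exact: abs_bounded_cvg (abs_bounded_regroup hB F2M).
have -> : Dseries Sigma f s = D := has_sum_limn (has_sum_regroup hB FD).
have zE : zeta s = z.
  apply: has_sum_limn; have -> : dirichlet_term (fun=> 1) s = fun q => (natpow q.+1 s)^-1.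
    by apply/funext => q; rewrite /dirichlet_term mul1r.
  exact: Zz.
(* Both H z and D are the sum over q of the rows (q + 1) ^ (- s) H: the former by linearity, the
   latter by grouping the product family along q. *)
rewrite zE HE mulrC; apply: has_sum_unique (has_sumZ H Zz).
apply: (has_sum_regroup (g := fst) _ FD) => q.
have [L FL rowL] := has_sum_row q F2M.
rewrite mulrC (has_sum_unique (has_sumZ (natpow q.+1 s)^-1 FH) rowL).
exact: FL.
Qed.
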